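(* Let $h\in M^1_G(0,T)$ and suppose that $A_t=\int_0^t h_s\,ds$, $t\in[0,T]$, is a process with stationary and independent increments w.r.t. the filtration. Then there is a constant $c\in\mathbb R$ such that $h\equiv c$ (as elements of $M^1_G(0,T)$).
   Context: **Sublinear expectations.** A sublinear expectation space $(\Omega,\mathcal H,\hat E)$ consists of a set $\Omega$, a vector lattice $\mathcal H$ of real functions on $\Omega$ containing the constants, and $\hat E:\mathcal H\to\mathbb R$ that is monotone, preserves constants, is sub-additive ($\hat E(X)-\hat E(Y)\le \hat E(X-Y)$) and positively homogeneous. $C_{l,Lip}(\mathbb R^n)$ is the set of continuous $\varphi$ with $|\varphi(x)-\varphi(y)|\le C(1+|x|^k+|y|^k)|x-y|$ for some $C,k$; $C_{b,Lip}$ is the set of bounded Lipschitz functions. Random vectors $X_1,X_2$ (possibly on different spaces) are identically distributed, $X_1\sim X_2$, if $\hat E_1[\varphi(X_1)]=\hat E_2[\varphi(X_2)]$ for all $\varphi\in C_{l,Lip}(\mathbb R^n)$. $Y$ is independent of $X$ if $\hat E[\varphi(X,Y)]=\hat E[\hat E[\varphi(x,Y)]_{x=X}]$ for all $\varphi\in C_{b,Lip}$. **$G$-expectation.** Fix $T>0$, $\overline\sigma>\underline\sigma>0$ and $G(a)=\frac12(\overline\sigma^2a^+-\underline\sigma^2a^-)$. A random variable $\xi$ is $G$-normal if $a\xi+b\hat\xi\sim\sqrt{a^2+b^2}\,\xi$ for all $a,b\ge0$, with $\hat\xi$ an independent copy of $\xi$, and $\frac12\hat E[a\xi^2]=G(a)$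 for all $a\in\mathbb R$. Let $\Omega_T=C_0([0,T];\mathbb R)$ (continuous paths starting at $0$, sup norm), $B$ the coordinate process, and $\mathcal H^0_T=\{\varphi(B_{t_1},\dots,B_{t_n}): n\ge1,\ t_i\in[0,T],\ \varphi\in C_{l,Lip}(\mathbb R^n)\}$. For $0=t_0<\dots<t_m\le T$ put $\hat E[\varphi(B_{t_1}-B_{t_0},\dots,B_{t_m}-B_{t_{m-1}})]=\tilde E[\varphi(\sqrt{t_1-t_0}\,\xi_1,\dots,\sqrt{t_m-t_{m-1}}\,\xi_m)]$, where the $\xi_i$ are $G$-normal on some sublinear expectation space with $\xi_{i+1}$ independent of $(\xi_1,\dots,\xi_i)$. $L^p_G(\Omega_T)$ ($p\ge1$) is the completion of $\mathcal H^0_T$ under $\|\xi\|_{p,G}=\hat E[|\xi|^p]^{1/p}$; $L^p_G(\Omega_t)$ is defined in the same way with time points in $[0,t]$. $\hat E$ extends continuously to $L^1_G(\Omega_T)$. **The space $M^p_G(0,T)$.** $L_{ip}(\Omega_t)=\{\varphi(B_{t_1},\dots,B_{t_n}): t_i\in[0,t],\ \varphi\in C_{b,Lip}(\mathbb R^n)\}$. $H^0_G(0,T)$ is the set of processes $\eta_t=\sum_{j=0}^{N-1}\xi_j1_{]t_j,t_{j+1}]}(t)$ with $0=t_0<\dots<t_N=T$ and $\xi_j\in L_{ip}(\Omega_{t_j})$. $M^p_G(0,T)$ is its completion under $\|\eta\|_{M^p_G}=\{\hat E\int_0^T|\eta_s|^p\,ds\}^{1/p}$. The map $\eta\mapsto\int_0^t\eta_s\,ds\in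 L^1_G(\Omega_t)$ extends continuously to $M^1_G(0,T)$. **Increments.** For elements of $L^1_G(\Omega_T)$, identity in distribution and independence are tested with bounded Lipschitz functions. $\{X_t\}$ has stationary increments if $X_{t+r}-X_{s+r}\sim X_t-X_s$ whenever $0\le s\le t$, $r\ge0$, $t+r\le T$. $\{X_t\}$ with $X_t\in L^1_G(\Omega_t)$ for every $t$ has independent increments w.r.t. the filtration if for all $0<s<T$ and $0\le s_0\le\dots\le s_m\le s\le t_0\le\dots\le t_n\le T$ the vector $(X_{t_1}-X_{t_0},\dots,X_{t_n}-X_{t_{n-1}})$ is independent of $(B_{s_1}-B_{s_0},\dots,B_{s_m}-B_{s_{m-1}})$. *)

(* Defs.v *)
From HB Require Import structures.
From mathcomp Require Import all_boot all_order all_algebra.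
From mathcomp Require Import all_classical all_reals all_analysis.

Set Implicit Arguments.
Unset Strict Implicit.
Unset Printing Implicit Defensive.

Import Order.TTheory GRing.Theory Num.Theory.
Import numFieldNormedType.Exports.

Local Open Scope classical_set_scope.
Local Open Scope ring_scope.

(* The norm of 'rV[R]_n is the max norm; as all norms of R^n are equivalent,  *)
(* both classes are the usual ones. The growth condition implies continuity.  *)
Definition ClLip (R : realType) (n : nat) : set ('rV[R]_n -> R) :=
  [set phi | exists (C : R) (k : nat), forall x y,
     `|phi x - phi y| <= C * (1 + `|x| ^+ k + `|y| ^+ k) * `|x - y|].

Definition CbLip (R : realType) (n : nat) : set ('rV[R]_n -> R) :=
  [set phi | (exists M : R, forall x, `|phi x| <= M) /\
             (exists C : R, forall x y, `|phi x - phi y| <= C * `|x - y|)].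

(* A sublinear expectation on H is a total function on Om -> R of which only  *)
(* the values on H matter.                                                    *)
Record sublinear_expectation (R : realType) (Om : Type)
    (H : set (Om -> R)) (E : (Om -> R) -> R) : Prop := {
  sle_cst : forall c : R, H (fun=> c) ;
  sle_add : forall f g, H f -> H g -> H (fun w => f w + g w) ;
  sle_scale : forall (a : R) f, H f -> H (fun w => a * f w) ;
  sle_max : forall f g, H f -> H g -> H (fun w => Num.max (f w) (g w)) ;
  sle_mono : forall f g, H f -> H g -> (forall w, f w <= g w) -> E f <= E g ;
  sle_const : forall c : R, E (fun=> c) = c ;
  sle_subadd : forall f g, H f -> H g -> E f - E g <= E (fun w => f w - g w) ;
  sle_poshom : forall (a : R) f, 0 <= a -> H f -> E (fun w => a * f w) = a * E f
}.

(* An n-dimensional random vector: phi(X) is in H for all phi in C_{l,Lip},   *)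
(* so that the expectations in the two definitions below make sense.          *)
Definition random_vector (R : realType) (Om : Type) (H : set (Om -> R))
    (n : nat) (X : Om -> 'rV[R]_n) : Prop :=
  forall phi, ClLip phi -> H (fun w => phi (X w)).

Definition idist (R : realType) (n : nat)
    (Om1 : Type) (H1 : set (Om1 -> R)) (E1 : (Om1 -> R) -> R)
    (X1 : Om1 -> 'rV[R]_n)
    (Om2 : Type) (H2 : set (Om2 -> R)) (E2 : (Om2 -> R) -> R)
    (X2 : Om2 -> 'rV[R]_n) : Prop :=
  [/\ random_vector H1 X1, random_vector H2 X2 &
      forall phi, ClLip phi -> E1 (fun w => phi (X1 w)) = E2 (fun w => phi (X2 w))].

(* Argument order: Y is independent of X. *)
Definition indep (R : realType) (Om : Type)
    (H : set (Om -> R)) (E : (Om -> R) -> R)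
    (m n : nat) (X : Om -> 'rV[R]_m) (Y : Om -> 'rV[R]_n) : Prop :=
  random_vector H (fun w => row_mx (X w) (Y w)) /\
  forall phi, CbLip phi ->
    E (fun w => phi (row_mx (X w) (Y w))) =
    E (fun w => E (fun w' => phi (row_mx (X w) (Y w')))).

(* sl and sh are the lower and upper volatilities.                            *)
Definition Gfun (R : realType) (sl sh a : R) : R :=
  2^-1 * (sh ^+ 2 * Num.max a 0 - sl ^+ 2 * Num.max (- a) 0).

Definition vec1 (R : realType) (Om : Type) (X : Om -> R) : Om -> 'rV[R]_1 :=
  fun w => \row_(i < 1) X w.

Definition G_normal (R : realType) (sl sh : R) (Om : Type)
    (H : set (Om -> R)) (E : (Om -> R) -> R) (xi : Om -> R) : Prop :=
  (exists xi' : Om -> R,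
     [/\ idist H E (vec1 xi') H E (vec1 xi),
         indep H E (vec1 xi) (vec1 xi') &
         forall a b : R, 0 <= a -> 0 <= b ->
           idist H E (vec1 (fun w => a * xi w + b * xi' w))
                 H E (vec1 (fun w => Num.sqrt (a ^+ 2 + b ^+ 2) * xi w))]) /\
  (forall a : R, 2^-1 * E (fun w => a * xi w ^+ 2) = Gfun sl sh a).

(* C_0([0,T];R). Paths are functions on R set to 0 outside [0,T], so that a   *)
(* path is determined by its values on [0,T].                                 *)
Record path_space (R : realType) (T : R) := Path {
  path_fun :> R -> R ;
  path_cont : {within `[0, T], continuous path_fun} ;
  path_at0 : path_fun 0 = 0 ;
  path_out : forall t, ~ (0 <= t <= T) -> path_fun t = 0
}.

Definition Bproc (R : realType) (T : R) (t : R) : path_space T -> R := fun w => w t.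

(* Cylinder functions with time points in [0,t] and C_{l,Lip}, resp.          *)
(* C_{b,Lip}, test functions.                                                 *)
Definition cyl_space (R : realType) (T t : R) : set (path_space T -> R) :=
  [set f | exists (n : nat) (u : 'I_n.+1 -> R) (phi : 'rV[R]_n.+1 -> R),
     [/\ forall i, 0 <= u i <= t, ClLip phi &
         f = fun w => phi (\row_i Bproc (u i) w)]].

Definition Lip_space (R : realType) (T t : R) : set (path_space T -> R) :=
  [set f | exists (n : nat) (u : 'I_n.+1 -> R) (phi : 'rV[R]_n.+1 -> R),
     [/\ forall i, 0 <= u i <= t, CbLip phi &
         f = fun w => phi (\row_i Bproc (u i) w)]].

(* E is the G-expectation on cyl_space T: its values are the expectations of  *)
(* the corresponding functions of a sequence xi_0, xi_1, ... of G-normal      *)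
(* variables, each independent of the vector of the previous ones.            *)
Definition G_expectation (R : realType) (sl sh T : R)
    (E : (path_space T -> R) -> R) : Prop :=
  sublinear_expectation (cyl_space T) E /\
  exists (Om : Type) (H : set (Om -> R)) (E' : (Om -> R) -> R)
         (xi : nat -> Om -> R),
    [/\ sublinear_expectation H E',
        forall i, G_normal sl sh H E' (xi i),
        forall i, indep H E' (fun w => \row_(j < i.+1) xi j w) (vec1 (xi i.+1)) &
        forall (m : nat) (t : nat -> R) (phi : 'rV[R]_m -> R),
          (0 < m)%N -> t 0%N = 0 ->
          (forall i, (i < m)%N -> t i < t i.+1) -> t m <= T -> ClLip phi ->
          E (fun w => phi (\row_(i < m) (Bproc (t i.+1) w - Bproc (t i) w))) =
          E' (fun w => phi (\row_(i < m) (Num.sqrt (t i.+1 - t i) * xi i w)))].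

(* The completion of a subspace D of V under a seminorm N is realized by the  *)
(* N-Cauchy sequences of elements of D, two of which represent the same       *)
(* element when the seminorm of their difference tends to 0. Maps defined on  *)
(* D that are uniformly continuous for N are extended to the completion by    *)
(* applying them termwise.                                                    *)
Definition completion (R : realType) (V : zmodType) (D : set V) (N : V -> R) :
    set (nat -> V) :=
  [set x | (forall k, D (x k)) /\
           forall e : R, 0 < e -> exists K : nat, forall k l,
             (K <= k)%N -> (K <= l)%N -> N (x k - x l) < e].

Definition completion_eq (R : realType) (V : zmodType) (N : V -> R)
    (x y : nat -> V) : Prop :=
  (fun k => N (x k - y k)) @ \oo --> (0 : R).

Definition L1_norm (R : realType) (T : R) (E : (path_space T -> R) -> R)
    (f : path_space T -> R) : R := E (fun w => `|f w|).

Definition L1G (R : realType) (T : R) (E : (path_space T -> R) -> R) (t : R) :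
    set (nat -> path_space T -> R) :=
  completion (cyl_space t) (L1_norm E).

Definition Eext (R : realType) (T : R) (E : (path_space T -> R) -> R)
    (X : nat -> path_space T -> R) : R :=
  limn (fun k => E (X k)).

Definition simple_process (R : realType) (T : R) : set (R -> path_space T -> R) :=
  [set eta | exists (N : nat) (t : nat -> R) (xi : nat -> path_space T -> R),
     [/\ t 0%N = 0, t N = T,
         forall j, (j < N)%N -> t j < t j.+1,
         forall j, (j < N)%N -> Lip_space (t j) (xi j) &
         eta = fun s w => \sum_(j < N) xi j w * \1_(`]t j, t j.+1]) s]].

Definition M1_norm (R : realType) (T : R) (E : (path_space T -> R) -> R)
    (eta : R -> path_space T -> R) : R :=
  E (fun w => \int[lebesgue_measure]_(s in `[0, T]) `|eta s w|).

Definition M1G (R : realType) (T : R) (E : (path_space T -> R) -> R) :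
    set (nat -> R -> path_space T -> R) :=
  completion (@simple_process R T) (M1_norm E).

Definition M1_eq (R : realType) (T : R) (E : (path_space T -> R) -> R)
    (h g : nat -> R -> path_space T -> R) : Prop :=
  completion_eq (M1_norm E) h g.

(* Elements of simple_process vanish at 0 and beyond T, hence the indicator.  *)
Definition M1_const (R : realType) (T c : R) : nat -> R -> path_space T -> R :=
  fun _ s _ => c * \1_(`]0, T]) s.
Arguments M1_const {R} T c k s w.

(* The termwise extension of the pathwise integral of simple processes.       *)
Definition integral_process (R : realType) (T : R)
    (h : nat -> R -> path_space T -> R) : R -> nat -> path_space T -> R :=
  fun t k w => \int[lebesgue_measure]_(s in `[0, t]) h k s w.

(* A vector of elements of L^1_G(Omega_T) is a sequence X of maps             *)
(* path_space T -> 'rV_n with components in L^1_G(Omega_T); for phi in C_{b,Lip}, *)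
(* the element phi(X) of L^1_G(Omega_T) is fun k w => phi (X k w).            *)
Definition L1_idist (R : realType) (T : R) (E : (path_space T -> R) -> R) (n : nat)
    (X Y : nat -> path_space T -> 'rV[R]_n) : Prop :=
  forall phi, CbLip phi ->
    Eext E (fun k w => phi (X k w)) = Eext E (fun k w => phi (Y k w)).

(* Argument order: Y is independent of X. *)
Definition L1_indep (R : realType) (T : R) (E : (path_space T -> R) -> R) (m n : nat)
    (X : nat -> path_space T -> 'rV[R]_m) (Y : nat -> path_space T -> 'rV[R]_n) : Prop :=
  forall phi, CbLip phi ->
    Eext E (fun k w => phi (row_mx (X k w) (Y k w))) =
    Eext E (fun k w => Eext E (fun l w' => phi (row_mx (X k w) (Y l w')))).

Definition stationary_increments (R : realType) (T : R)
    (E : (path_space T -> R) -> R) (X : R -> nat -> path_space T -> R) : Prop :=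
  forall s t r : R, 0 <= s -> s <= t -> 0 <= r -> t + r <= T ->
    L1_idist E (fun k => vec1 (X (t + r) k - X (s + r) k))
               (fun k => vec1 (X t k - X s k)).

Definition independent_increments (R : realType) (T : R)
    (E : (path_space T -> R) -> R) (X : R -> nat -> path_space T -> R) : Prop :=
  (forall t, 0 <= t <= T -> L1G E t (X t)) /\
  forall (s : R) (m n : nat) (u v : nat -> R),
    0 < s < T ->
    0 <= u 0%N -> (forall i, (i < m)%N -> u i <= u i.+1) -> u m <= s ->
    s <= v 0%N -> (forall i, (i < n)%N -> v i <= v i.+1) -> v n <= T ->
    L1_indep E (fun _ w => \row_(i < m) (Bproc (u i.+1) w - Bproc (u i) w))
               (fun k w => \row_(i < n) (X (v i.+1) k w - X (v i) k w)).

(* Main.v *)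
Require Import Defs.
From mathcomp Require Import all_boot all_order all_algebra.
From mathcomp Require Import all_classical all_reals all_analysis.
From mathcomp Require Import measurable_realfun ring lra.

Set Implicit Arguments.
Unset Strict Implicit.
Unset Printing Implicit Defensive.

Import Order.TTheory GRing.Theory Num.Theory.
Import numFieldNormedType.Exports.

Local Open Scope classical_set_scope.
Local Open Scope ring_scope.

(** Cut [0,T] into 2p cells of length d = T/(2p) and let a_j be the increment
of A = \int h over the j-th cell. Two facts about a_j conflict unless A is
deterministic.

On the one hand, h is close in M^1 to a simple process g with bounded
variation in time, so consecutive increments nearly agree: the sum over i < p
of |a_2i - a_(2i+1)| is of order d, up to the M^1 distance between h and g
(sum_int_oc_consecutive). On the other hand, a_(2i+1) is independent of the
past, hence of a_2i, so for the law of an increment (the same for all cells,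
by stationarity) the conditional mean of |a_2i - a_(2i+1)| is at least
r = inf_y E|y - a_0|. Peeling off one pair of cells after the other gives
E sum_i |a_2i - a_(2i+1)| >= p r (indep_expectation_ge): here independence
turns the sublinear expectation of a sum into a sum of expectations from below.
Together, p r is small, so some constant y satisfies p E|y - a_j| small for
every j. Summing over the cells, which only takes sub-additivity, h is close in
M^1 to the constant y/d (M1G_near_const). Being a limit of constants, h is a
constant, namely the limit of E[A_T]/T along the approximating sequence
(M1G_const).

Test functions are bounded, so |x - y| is replaced by the truncated distance
min(|x - y|, 2 d B), where B bounds g. This loses nothing, because the constant
may be projected onto [-B, B] and the increments of g lie in [-d B, d B].

To apply independence, the past has to be a bounded Lipschitz function of
increments of the canonical process. This is handled by describing such
functions intrinsically, as bounded path functionals that are Lipschitz with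
respect to the values at finitely many times; a McShane extension
(CbLip_extension) produces the test function on the finite-dimensional space. *)

(** * Sublinear expectations *)

Section SublinearExpectation.
Context {R : realType} {Om : Type} {H : set (Om -> R)} {E : (Om -> R) -> R}.
Hypothesis hE : sublinear_expectation H E.

Lemma sle_sub f g : H f -> H g -> H (fun w => f w - g w).
Proof.
move=> hf hg.
have -> : (fun w => f w - g w) = (fun w => f w + -1 * g w).
  by apply/funext => w; rewrite mulN1r.
exact: (sle_add hE hf (sle_scale hE (-1) hg)).
Qed.

Lemma sle_norm f : H f -> H (fun w => `|f w|).
Proof.
move=> hf; have -> : (fun w => `|f w|) = (fun w => Num.max (f w) (-1 * f w)).
  by apply/funext => w; rewrite mulN1r maxrN.
exact: (sle_max hE hf (sle_scale hE (-1) hf)).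
Qed.

Lemma sle_sum n (f : 'I_n -> Om -> R) :
  (forall i, H (f i)) -> H (fun w => \sum_(i < n) f i w).
Proof.
move=> hf; elim: n f hf => [|n IH] f hf.
  have -> : (fun w => \sum_(i < 0) f i w) = (fun=> 0).
    by apply/funext => w; rewrite big_ord0.
  exact: (sle_cst hE 0).
have -> : (fun w => \sum_(i < n.+1) f i w) =
   (fun w => \sum_(i < n) f (widen_ord (leqnSn n) i) w + f ord_max w).
  by apply/funext => w; rewrite big_ord_recr.
exact: (sle_add hE (IH _ (fun i => hf _)) (hf _)).
Qed.

Lemma sle_leD f g : H f -> H g -> E (fun w => f w + g w) <= E f + E g.
Proof.
move=> hf hg; have := sle_subadd hE (sle_add hE hf hg) hg.
rewrite (_ : (fun w => f w + g w - g w) = f).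
  by move=> ?; rewrite -lerBlDr.
by apply/funext => w; rewrite addrK.
Qed.

Lemma sle_Dcst f (c : R) : H f -> E (fun w => f w + c) = E f + c.
Proof.
move=> hf; apply/eqP; rewrite eq_le; apply/andP; split.
  by rewrite (le_trans (sle_leD hf (sle_cst hE c)))// (sle_const hE).
have := sle_leD (sle_add hE hf (sle_cst hE c)) (sle_cst hE (- c)).
rewrite (sle_const hE) (_ : (fun w => _ + - c) = f).
  by move=> ?; rewrite -lerBrDr.
by apply/funext => w; rewrite addrK.
Qed.

Lemma sle_dist f g : H f -> H g -> `|E f - E g| <= E (fun w => `|f w - g w|).
Proof.
move=> hf hg.
have aux a b : H a -> H b -> E a - E b <= E (fun w => `|a w - b w|).
  move=> ha hb; apply: (le_trans (sle_subadd hE ha hb)).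
  apply: (sle_mono hE); [exact: sle_sub|exact/sle_norm/sle_sub|].
  by move=> w; exact: ler_norm.
rewrite ler_norml aux// andbT lerNl opprB.
have := aux _ _ hg hf.
by rewrite (_ : (fun w => `|g w - f w|) = (fun w => `|f w - g w|))//;
  apply/funext => w; rewrite distrC.
Qed.

Lemma sle_sum_le n (f : 'I_n -> Om -> R) (c : 'I_n -> R) :
  (forall i, H (f i)) -> (forall i, E (f i) <= c i) ->
  E (fun w => \sum_(i < n) f i w) <= \sum_(i < n) c i.
Proof.
elim: n f c => [|n IH] f c hf hc.
  have -> : (fun w => \sum_(i < 0) f i w) = (fun=> 0).
    by apply/funext => w; rewrite big_ord0.
  by rewrite (sle_const hE) big_ord0.
have -> : (fun w => \sum_(i < n.+1) f i w) =
   (fun w => \sum_(i < n) f (widen_ord (leqnSn n) i) w + f ord_max w).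
  by apply/funext => w; rewrite big_ord_recr.
rewrite big_ord_recr/=; apply: (le_trans (sle_leD (sle_sum (fun i => hf _)) (hf _))).
by apply: lerD; [exact: IH|exact: hc].
Qed.

End SublinearExpectation.

(** * Lipschitz cylinder functions *)

Lemma rV_norm_le (R : realType) n (x : 'rV[R]_n) (c : R) :
  0 <= c -> (forall i, `|x 0 i| <= c) -> `|x| <= c.
Proof.
move=> c0 hx; rewrite /Num.norm/= mx_normrE; apply/bigmax_leP; split => // -[i j] _ /=.
by rewrite ord1.
Qed.

Lemma rV_coord_le (R : realType) n (x : 'rV[R]_n) i : `|x 0 i| <= `|x|.
Proof.
by rewrite /Num.norm/= mx_normrE; apply: (le_bigmax _ (fun ij => `|x ij.1 ij.2|) (0, i)).
Qed.

Lemma ClLip_CbLip (R : realType) n (phi : 'rV[R]_n -> R) : CbLip phi -> ClLip phi.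
Proof.
move=> [_ [C hC]]; exists `|C|, 0%N => x y; rewrite !expr0.
apply: (le_trans (hC x y)); rewrite -mulrA.
apply: (@le_trans _ _ (`|C| * `|x - y|)); first by rewrite ler_wpM2r// ler_norm.
by rewrite ler_wpM2l// ler_peMl//; lra.
Qed.

Lemma cyl_Lip (R : realType) (T t : R) (f : path_space T -> R) :
  Lip_space t f -> cyl_space t f.
Proof.
by move=> [n [u [phi [hu /ClLip_CbLip hphi ->]]]]; exists n, u, phi.
Qed.

(** McShane extension: phi is the infimal convolution of f with C |.|, cut off at
the bound M. It lets one check that a path functional is a test function of
some coordinates p without describing the range of p. *)
Lemma CbLip_extension (R : realType) (X : Type) n (p : X -> 'rV[R]_n)
    (f : X -> R) (M C : R) : 0 <= C ->
  (forall x, `|f x| <= M) -> (forall x y, `|f x - f y| <= C * `|p x - p y|) ->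
  exists phi, CbLip phi /\ forall x, phi (p x) = f x.
Proof.
move=> C0 hM hC.
have [[x0]|X0] := pselect (inhabited X); last first.
  exists (fun=> 0); split; last by move=> x; case: X0.
  by split; [exists 0 => x; rewrite normr0|exists 0 => x y; rewrite subr0 normr0 mul0r].
pose A z := [set f x + C * `|z - p x| | x in [set: X]].
have A0 z : A z !=set0 by exists (f x0 + C * `|z - p x0|), x0.
have Al z : lbound (A z) (- M).
  move=> _ [x _ <-]; rewrite ler_wpDr ?mulr_ge0//.
  by have := hM x; rewrite ler_norml => /andP[].
have Ainf z x : inf (A z) <= f x + C * `|z - p x|.
  by apply: ge_inf; [exists (- M)|exists x].
have Alip z z' : inf (A z) <= inf (A z') + C * `|z - z'|.
  rewrite -lerBlDr; apply: lb_le_inf => // _ [x _ <-].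
  rewrite lerBlDr (le_trans (Ainf z x))// -addrA lerD2l -mulrDr ler_wpM2l//.
  by rewrite [leRHS]addrC ler_distD.
exists (fun z => Num.max (- M) (Num.min (inf (A z)) M)).
have M0 : 0 <= M by apply: le_trans (hM x0).
split; first split.
- exists M => z; rewrite ler_norml; apply/andP; split; first by rewrite le_max lexx.
  by rewrite ge_max ge_min lexx orbT andbT; lra.
- exists C => z z'; have := Alip z z'; have := Alip z' z.
  rewrite (distrC z').
  move: (inf (A z)) (inf (A z')) => a b h1 h2.
  have h0 : 0 <= C * `|z - z'| by rewrite mulr_ge0.
  rewrite /Num.min; case: (ltP a M) => ?; case: (ltP b M) => ?;
    by rewrite /Num.max; do 2?case: (ltP (- M) _) => ?; rewrite ler_norml; apply/andP; split; lra.
- move=> x.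
  have -> : inf (A (p x)) = f x.
    apply/eqP; rewrite eq_le; apply/andP; split.
      by rewrite (le_trans (Ainf _ x))// subrr normr0 mulr0 addr0.
    apply: lb_le_inf => // _ [y _ <-].
    by have := hC x y; rewrite ler_norml => /andP[_]; rewrite lerBlDl.
  have := hM x; rewrite ler_norml => /andP[h1 h2].
  by rewrite (min_idPl h2) (max_idPr h1).
Qed.

Section LipCyl.
Context {R : realType} {T : R}.
Implicit Types (f g : path_space T -> R) (w : path_space T) (s : seq R) (t : R).

Definition path_dist s (w w' : path_space T) : R := \sum_(u <- s) `|w u - w' u|.

(** The functions of Lip_space t, see Lip_spaceP, described without a test
function: closure under Lipschitz operations then needs no common tuple of time
points, only the concatenation of two lists. *)
Definition lip_cyl t f : Prop :=
  exists s (M C : R), [/\ {in s, forall u, 0 <= u <= t}, 0 <= C,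
    forall w, `|f w| <= M & forall w w', `|f w - f w'| <= C * path_dist s w w'].

Lemma path_dist_ge0 s w w' : 0 <= path_dist s w w'.
Proof. by apply: sumr_ge0. Qed.

Lemma path_dist_cat s s' w w' :
  path_dist (s ++ s') w w' = path_dist s w w' + path_dist s' w w'.
Proof. by rewrite /path_dist big_cat. Qed.

Lemma path_dist_le s w w' (c : R) : {in s, forall u, `|w u - w' u| <= c} ->
  path_dist s w w' <= (size s)%:R * c.
Proof.
rewrite /path_dist; elim: s => [|u s IH] hc; first by rewrite big_nil mul0r.
rewrite big_cons/= -natr1 mulrDl mul1r addrC; apply: lerD; last first.
  by apply: hc; rewrite mem_head.
by apply: IH => v vs; apply: hc; rewrite in_cons vs orbT.
Qed.

Lemma Lip_spaceP t f : 0 <= t -> Lip_space t f <-> lip_cyl t f.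
Proof.
move=> t0; split.
  move=> [n [u [phi [hu [[M hM] [C hC]] ->]]]].
  exists [seq u i | i <- enum 'I_n.+1], M, `|C|; split => //.
    by move=> _ /mapP[i _ ->].
  move=> w w'; apply: (le_trans (hC _ _)).
  apply: (@le_trans _ _ (`|C| * `|(\row_i Bproc (u i) w) - (\row_i Bproc (u i) w')|)).
    by rewrite ler_wpM2r// ler_norm.
  rewrite ler_wpM2l//; apply: rV_norm_le; first exact: path_dist_ge0.
  move=> i; rewrite !mxE /path_dist big_map big_enum/= /Bproc (bigD1 i)//= lerDl.
  exact: sumr_ge0.
move=> [s [M [C [hs C0 hM hC]]]].
pose u (i : 'I_(size s).+1) := nth 0 (0 :: s) i.
have [| |phi [hphi ef]] := @CbLip_extension R (path_space T) _
    (fun w => \row_i Bproc (u i) w) f M (C * (size s)%:R) _ hM.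
- by rewrite mulr_ge0.
- move=> w w'; apply: (le_trans (hC w w')); rewrite -mulrA ler_wpM2l//.
  apply: path_dist_le => v /(nthP 0)[i si <-].
  have := rV_coord_le ((\row_i Bproc (u i) w) - (\row_i Bproc (u i) w'))
    (lift ord0 (Ordinal si)).
  by rewrite !mxE.
exists (size s), u, phi; split => //; last by apply/funext => w; rewrite ef.
move=> [[|i] hi]; rewrite /u/=; first by rewrite lexx.
by apply: hs; apply: mem_nth.
Qed.

Lemma lip_cyl_mono t t' f : t <= t' -> lip_cyl t f -> lip_cyl t' f.
Proof.
move=> tt' [s [M [C [hs C0 hM hC]]]]; exists s, M, C; split => // u /hs /andP[-> ut].
exact: le_trans tt'.
Qed.

Lemma lip_cyl_cst t c : lip_cyl t (fun=> c).
Proof.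
exists [::], `|c|, 0; split => // w w'.
by rewrite subrr normr0 mul0r.
Qed.

Lemma lip_cyl_comp2 t f g (psi : R -> R -> R) (C : R) :
  (forall a b a' b', `|psi a b - psi a' b'| <= C * (`|a - a'| + `|b - b'|)) ->
  lip_cyl t f -> lip_cyl t g -> lip_cyl t (fun w => psi (f w) (g w)).
Proof.
move=> hpsi [s [M [D [hs D0 hM hD]]]] [s' [M' [D' [hs' D0' hM' hD']]]].
have {}hpsi a b a' b' : `|psi a b - psi a' b'| <= `|C| * (`|a - a'| + `|b - b'|).
  by apply: (le_trans (hpsi _ _ _ _)); rewrite ler_wpM2r ?ler_norm// addr_ge0.
exists (s ++ s'), (`|psi 0 0| + `|C| * (M + M')), (`|C| * (D + D')); split.
- by move=> u; rewrite mem_cat => /orP[/hs|/hs'].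
- by rewrite mulr_ge0// addr_ge0.
- move=> w; rewrite -[psi (f w) (g w)](subrK (psi 0 0)).
  rewrite (le_trans (ler_normD _ _))// addrC lerD2l (le_trans (hpsi _ _ _ _))//.
  by rewrite ler_wpM2l// !subr0 lerD.
- move=> w w'; rewrite (le_trans (hpsi _ _ _ _))// -mulrA ler_wpM2l//.
  rewrite path_dist_cat; have := hD w w'; have := hD' w w'.
  have := mulr_ge0 D0 (path_dist_ge0 s' w w').
  have := mulr_ge0 D0' (path_dist_ge0 s w w').
  rewrite mulrDl !mulrDr.
  by move: (D * _) (D * _) (D' * _) (D' * _) => *; lra.
Qed.

Lemma lip_cylB t f g : lip_cyl t f -> lip_cyl t g -> lip_cyl t (fun w => f w - g w).
Proof.
apply: (@lip_cyl_comp2 _ _ _ (fun a b => a - b) 1) => a b a' b'.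
by rewrite mul1r opprD opprK addrACA (addrC (- b)) (distrC b) ler_normD.
Qed.

Lemma lip_cylD t f g : lip_cyl t f -> lip_cyl t g -> lip_cyl t (fun w => f w + g w).
Proof.
apply: (@lip_cyl_comp2 _ _ _ (fun a b => a + b) 1) => a b a' b'.
by rewrite mul1r opprD addrACA ler_normD.
Qed.

Lemma lip_cyl_sum t n (f : 'I_n -> path_space T -> R) :
  (forall i, lip_cyl t (f i)) -> lip_cyl t (fun w => \sum_(i < n) f i w).
Proof.
elim: n f => [|n IH] f hf.
  have -> : (fun w => \sum_(i < 0) f i w) = (fun=> 0).
    by apply/funext => w; rewrite big_ord0.
  exact: lip_cyl_cst.
have -> : (fun w => \sum_(i < n.+1) f i w) =
   (fun w => \sum_(i < n) f (widen_ord (leqnSn n) i) w + f ord_max w).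
  by apply/funext => w; rewrite big_ord_recr.
exact: (lip_cylD (IH _ (fun i => hf _)) (hf _)).
Qed.

Definition increments m (v : nat -> R) (w : path_space T) : 'rV[R]_m :=
  \row_(i < m) (Bproc (v i.+1) w - Bproc (v i) w).

(** Sort the times: every value at a listed time is a sum of successive
increments starting from the value 0 at time 0. Independence is stated in terms
of increments over ordered times, the functionals in terms of values. *)
Lemma path_dist_increments s t : 0 <= t -> {in s, forall u, 0 <= u <= t} ->
  exists m v (C : R), [/\ 0 <= C, v 0%N = 0,
    forall i, (i < m)%N -> v i <= v i.+1, v m <= t &
    forall w w', path_dist s w w' <= C * `|increments m v w - increments m v w'|].
Proof.
move=> t0 hs; pose l := sort <=%R s; pose v := nth 0 (0 :: l).
have memv : {in 0 :: l, forall u, 0 <= u <= t}.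
  move=> u; rewrite in_cons => /predU1P[->|]; first by rewrite lexx.
  by rewrite mem_sort => /hs.
have vmono i : (i < size l)%N -> v i <= v i.+1.
  have : path <=%R 0 l.
    rewrite path_sortedE; last exact: le_trans.
    rewrite (sort_sorted (@le_total _ _)) andbT; apply/allP => u ul.
    by have /memv/andP[] : u \in 0 :: l by rewrite in_cons ul orbT.
  by move=> /(pathP 0) h /h.
exists (size l), v, ((size s)%:R * (size l)%:R); split => //.
- have /memv/andP[] // : v (size l) \in 0 :: l by exact: mem_nth.
- move=> w w'; rewrite -mulrA; apply: path_dist_le => u us.
  have /(nthP 0)[k sk <-] : u \in 0 :: l by rewrite in_cons mem_sort us orbT.
  rewrite /= ltnS in sk.
  have wE (z : path_space T) : z (v k) = \sum_(0 <= j < k) (z (v j.+1) - z (v j)).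
    by rewrite (telescope_sumr (fun j => z (v j)))// [v 0%N]/= path_at0 subr0.
  rewrite -/(v k) !wE -sumrB big_mkord.
  apply: (le_trans (ler_norm_sum _ _ _)).
  pose inc := increments (size l) v w - increments (size l) v w'.
  apply: (@le_trans _ _ (\sum_(j < k) `|inc|)).
    apply: ler_sum => j _.
    have := rV_coord_le inc (Ordinal (leq_trans (ltn_ord j) sk)).
    by rewrite !mxE/=.
  by rewrite sumr_const card_ord -[leLHS]mulr_natl ler_wpM2r// ler_nat.
Qed.

End LipCyl.

(** * Integrals of simple processes *)

Section PathIntegral.
Context {R : realType}.
Implicit Types (f g : R -> R) (a b c : R).

Definition meas_bounded f : Prop :=
  measurable_fun setT f /\ exists M, forall x, `|f x| <= M.

Lemma meas_bounded_integrable f b : meas_bounded f ->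
  (@lebesgue_measure R).-integrable `[0, b] (EFin \o f).
Proof.
move=> [mf [M hM]]; apply: measurable_bounded_integrable => //.
- rewrite /= lebesgue_measure_itv/=.
  by case: ifPn => // _; rewrite -EFinB ltry.
- exact: measurable_funTS.
- by exists M; split; [exact: num_real|move=> x Mx y _ /=; rewrite (le_trans _ (ltW Mx))].
Qed.

Lemma meas_boundedB f g :
  meas_bounded f -> meas_bounded g -> meas_bounded (fun x => f x - g x).
Proof.
move=> [mf [M hM]] [mg [M' hM']]; split; first exact: measurable_funB.
by exists (M + M') => x; rewrite (le_trans (ler_normB _ _))// lerD.
Qed.

Lemma meas_bounded_cst c : meas_bounded (fun=> c).
Proof. by split; [exact: measurable_cst|exists `|c|]. Qed.

Lemma meas_bounded_norm f : meas_bounded f -> meas_bounded (fun x => `|f x|).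
Proof.
move=> [mf [M hM]]; split; first exact: measurableT_comp.
by exists M => x; rewrite normr_id.
Qed.

(** The integral over ]a, b], see int_ocE. Written as a difference, it is
convertible to the increments of integral_process. *)
Definition int_oc f a b : R :=
  \int[lebesgue_measure]_(x in `[0, b]) f x - \int[lebesgue_measure]_(x in `[0, a]) f x.

Lemma int_ocE f a b : 0 <= a <= b -> meas_bounded f ->
  int_oc f a b = \int[lebesgue_measure]_(x in `]a, b]) f x.
Proof.
move=> /andP[a0 ab] hf; rewrite /int_oc Rintegral_itvB//.
exact: meas_bounded_integrable.
Qed.

Lemma int_oc_integrable f a b : 0 <= a <= b -> meas_bounded f ->
  (@lebesgue_measure R).-integrable `]a, b] (EFin \o f).
Proof.
move=> /andP[a0 ab] hf; apply: integrableS (meas_bounded_integrable b hf) => //.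
by apply: subset_itvr; rewrite bnd_simp.
Qed.

Lemma int_oc_chain f a b c : int_oc f a b + int_oc f b c = int_oc f a c.
Proof. by rewrite /int_oc addrC addrA subrK. Qed.

Lemma int_oc_cst a b c : 0 <= a <= b -> int_oc (fun=> c) a b = (b - a) * c.
Proof.
move=> ab; rewrite int_ocE//; last exact: meas_bounded_cst.
rewrite Rintegral_cst//= lebesgue_measure_itv/= lte_fin.
case: ltP => [_|ba] /=; first by rewrite mulrC.
by rewrite mulr0 (_ : b = a) ?subrr ?mul0r//; apply/eqP; rewrite eq_le ba; case/andP: ab.
Qed.

Lemma int_ocB f g a b : meas_bounded f -> meas_bounded g ->
  int_oc (fun x => f x - g x) a b = int_oc f a b - int_oc g a b.
Proof.
move=> hf hg; rewrite /int_oc !RintegralB//; try exact: meas_bounded_integrable.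
lra.
Qed.

Lemma int_oc_le f g a b : 0 <= a <= b -> meas_bounded f -> meas_bounded g ->
  (forall x, a < x <= b -> f x <= g x) -> int_oc f a b <= int_oc g a b.
Proof.
move=> ab hf hg fg; rewrite !int_ocE//.
by apply: le_Rintegral => //; exact: int_oc_integrable.
Qed.

Lemma int_oc_norm f a b : 0 <= a <= b -> meas_bounded f ->
  `|int_oc f a b| <= int_oc (fun x => `|f x|) a b.
Proof.
move=> ab hf; rewrite !int_ocE//; last exact: meas_bounded_norm.
exact/le_normr_Rintegral/int_oc_integrable.
Qed.

Lemma int_oc0 f b : meas_bounded f ->
  \int[lebesgue_measure]_(x in `[0, b]) f x = int_oc f 0 b.
Proof. by move=> hf; rewrite /int_oc set_itv1 Rintegral_set1 subr0. Qed.

Lemma int_oc_norm_le f a b c : 0 <= a <= b -> meas_bounded f ->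
  (forall x, a < x <= b -> `|f x| <= c) -> `|int_oc f a b| <= (b - a) * c.
Proof.
move=> ab hf hc; rewrite (le_trans (int_oc_norm ab hf))// -int_oc_cst//.
apply: int_oc_le => //; [exact: meas_bounded_norm|exact: meas_bounded_cst].
Qed.

Lemma int_oc_dist_le f a b z v : 0 <= a <= b -> meas_bounded f ->
  (forall x, a < x <= b -> `|f x - z| <= v) ->
  `|int_oc f a b - (b - a) * z| <= (b - a) * v.
Proof.
move=> ab hf hz; rewrite -[(b - a) * z]int_oc_cst//.
rewrite -int_ocB//; last exact: meas_bounded_cst.
by apply: int_oc_norm_le => //; apply: meas_boundedB => //; exact: meas_bounded_cst.
Qed.

Lemma sum_int_oc f (u : nat -> R) n :
  \sum_(i < n) int_oc f (u i) (u i.+1) = int_oc f (u 0%N) (u n).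
Proof.
elim: n => [|n IH]; first by rewrite big_ord0 /int_oc subrr.
by rewrite big_ord_recr/= IH int_oc_chain.
Qed.

(** Bounded variation: the oscillations on the cells of any grid sum up to at
most V. The cells are closed, because f on ]u i, u i.+1] is compared with its
value at u i. *)
Definition oscillation_le (V : R) f : Prop :=
  forall (u : nat -> R) n, (forall i, u i <= u i.+1) ->
  exists v : nat -> R, \sum_(i < n) v i <= V /\
    forall i x y, u i <= x <= u i.+1 -> u i <= y <= u i.+1 -> `|f x - f y| <= v i.

Lemma oscillation_leD V W f g : oscillation_le V f -> oscillation_le W g ->
  oscillation_le (V + W) (fun x => f x + g x).
Proof.
move=> hf hg u n hu; have [v [sv hv]] := hf u n hu; have [v' [sv' hv']] := hg u n hu.
exists (fun i => v i + v' i); split; first by rewrite big_split lerD.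
move=> i x y hx hy; rewrite opprD addrACA (le_trans (ler_normD _ _))// lerD//.
  exact: hv.
exact: hv'.
Qed.

(** The indicator of ]a, b] is a difference of two nonincreasing functions, and
the oscillations of a monotone function telescope. *)
Lemma oscillation_le_indic a b c :
  a <= b -> oscillation_le (2 * `|c|) (fun x => c * \1_(`]a, b]) x).
Proof.
move=> ab u n hu.
pose h (e x : R) : R := (x <= e)%R%:R.
have hanti (e x y : R) : x <= y -> h e y <= h e x.
  by rewrite /h => xy; case: (leP y e) => // ye; rewrite (le_trans xy ye).
have indE (x : R) : \1_(`]a, b]) x = h b x - h a x.
  rewrite /h indicE mem_setE in_itv/=.
  case: (leP x a) => xa /=; last by rewrite subr0.
  by rewrite (le_trans xa ab) subrr.
have sumh (e : R) : \sum_(i < n) (h e (u i) - h e (u i.+1)) <= 1.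
  rewrite -(big_mkord xpredT (fun i => h e (u i) - h e (u i.+1))).
  rewrite -[X in X <= _]opprK -sumrN.
  under eq_bigr do rewrite opprB.
  rewrite (telescope_sumr (fun i => h e (u i)))// opprB /h.
  by case: (_ <= e); case: (_ <= e); rewrite /=; lra.
exists (fun i => `|c| * ((h b (u i) - h b (u i.+1)) + (h a (u i) - h a (u i.+1)))).
split.
  by rewrite -mulr_sumr big_split/= mulrC ler_wpM2r// lerD.
move=> i x y /andP[ux xu] /andP[uy yu]; rewrite -mulrBr normrM ler_wpM2l// !indE.
have := hanti b _ _ ux; have := hanti b _ _ xu.
have := hanti b _ _ uy; have := hanti b _ _ yu.
have := hanti a _ _ ux; have := hanti a _ _ xu.
have := hanti a _ _ uy; have := hanti a _ _ yu.
by rewrite ler_norml => *; apply/andP; split; lra.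
Qed.

(** On each cell, f may be replaced by its value at the left end point, and that
value by the average of f, each time at the cost of d times the oscillation. *)
Lemma int_oc_dist_cst V f x (d : R) n : 0 <= d -> oscillation_le V f -> meas_bounded f ->
  int_oc (fun s => `|f s - x|) 0 (d * n%:R) <=
  \sum_(i < n) `|int_oc f (d * i%:R) (d * i.+1%:R) - d * x| + 2 * d * V.
Proof.
move=> d0 hV hf.
pose u i := d * i%:R.
have dS i : u i.+1 - u i = d by rewrite /u -mulrBr -natr1 addrC addKr mulr1.
have uS i : u i <= u i.+1 by rewrite -subr_ge0 dS.
have u0 i : 0 <= u i by rewrite mulr_ge0.
have uu i : 0 <= u i <= u i.+1 by rewrite u0 uS.
have [v [sv hv]] := hV u n uS.
have hfx : meas_bounded (fun s => `|f s - x|).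
  by apply/meas_bounded_norm/meas_boundedB => //; exact: meas_bounded_cst.
rewrite -/(u n) -[X in int_oc _ X](_ : u 0%N = 0); last by rewrite /u mulr0.
rewrite -sum_int_oc.
apply: (@le_trans _ _ (\sum_(i < n)
    (`|int_oc f (u i) (u i.+1) - d * x| + 2 * d * v i))); last first.
  by rewrite big_split/= lerD2l -mulr_sumr ler_wpM2l// mulr_ge0.
apply: ler_sum => i _.
pose z := f (u i).
have hz s : u i < s <= u i.+1 -> `|f s - z| <= v i.
  by move=> /andP[/ltW us su]; apply: hv; rewrite ?us ?su ?lexx ?uS.
have h1 : int_oc (fun s => `|f s - x|) (u i) (u i.+1) <= d * (v i + `|z - x|).
  rewrite -[X in X * _](dS i) -int_oc_cst//.
  apply: int_oc_le => //; first exact: meas_bounded_cst.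
  by move=> s /hz hs; rewrite (le_trans (ler_distD z _ _))// lerD2r.
have h2 : `|int_oc f (u i) (u i.+1) - d * z| <= d * v i.
  by have := int_oc_dist_le (uu i) hf hz; rewrite dS.
apply: (le_trans h1); rewrite mulrDr.
have : d * `|z - x| <= `|int_oc f (u i) (u i.+1) - d * x| + d * v i.
  rewrite -[X in X * _](ger0_norm d0) -normrM mulrBr.
  rewrite (le_trans (ler_distD (int_oc f (u i) (u i.+1)) _ _))// addrC lerD2l.
  by rewrite distrC.
by lra.
Qed.

(** Both increments are compared with d times the value of f at the end point
that the two cells share. *)
Lemma sum_int_oc_consecutive V f (d : R) p : 0 <= d -> oscillation_le V f -> meas_bounded f ->
  \sum_(i < p) `|int_oc f (d * i.*2%:R) (d * i.*2.+1%:R) -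
                 int_oc f (d * i.*2.+1%:R) (d * i.*2.+2%:R)| <= 2 * d * V.
Proof.
move=> d0 hV hf.
pose u i := d * i.*2%:R; pose m i := d * i.*2.+1%:R.
have um i : m i - u i = d by rewrite /u /m -mulrBr -natr1 addrC addKr mulr1.
have mu i : u i.+1 - m i = d.
  by rewrite /u /m -mulrBr doubleS -(natr1 _.+1) addrC addKr mulr1.
have u_m i : u i <= m i by rewrite -subr_ge0 um.
have m_u i : m i <= u i.+1 by rewrite -subr_ge0 mu.
have [v [sv hv]] := hV u p (fun i => le_trans (u_m i) (m_u i)).
apply: (@le_trans _ _ (\sum_(i < p) (2 * d * v i))); last first.
  by rewrite -mulr_sumr ler_wpM2l// mulr_ge0.
apply: ler_sum => i _; rewrite -/(u i) -/(m i) -doubleS -/(u i.+1).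
pose z := f (m i).
have hz s : u i <= s <= u i.+1 -> `|f s - z| <= v i.
  by move=> us; apply: hv => //; rewrite u_m m_u.
have u0 : 0 <= u i by rewrite mulr_ge0.
have m0 : 0 <= m i by rewrite mulr_ge0.
have h1 : `|int_oc f (u i) (m i) - d * z| <= d * v i.
  rewrite -[d in d * z](um i) -[d in _ <= d * _](um i).
  apply: int_oc_dist_le; rewrite ?u0 ?u_m//.
  by move=> s /andP[us sm]; apply: hz; rewrite (ltW us) (le_trans sm).
have h2 : `|int_oc f (m i) (u i.+1) - d * z| <= d * v i.
  rewrite -[d in d * z](mu i) -[d in _ <= d * _](mu i).
  apply: int_oc_dist_le; rewrite ?m0 ?m_u//.
  by move=> s /andP[us sm]; apply: hz; rewrite sm (le_trans (u_m i) (ltW us)).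
rewrite (le_trans (ler_distD (d * z) _ _))// (distrC (d * z)).
by rewrite -(mulrA 2); lra.
Qed.

End PathIntegral.

Section SimpleProcess.
Context {R : realType} {T : R}.
Implicit Types (F G : R -> path_space T -> R) (w : path_space T) (t : R).

(** Bound and Lipschitz constant are uniform in the time variable, so that
integration in time yields a function in lip_cyl t. *)
Definition lip_process t F : Prop :=
  (forall w, measurable_fun setT (F^~ w)) /\
  exists (s : seq R) (M C : R), [/\ {in s, forall u, 0 <= u <= t}, 0 <= C,
    forall r w, `|F r w| <= M &
    forall r w w', `|F r w - F r w'| <= C * path_dist s w w'].

Lemma lip_process_meas t F w : lip_process t F -> meas_bounded (F^~ w).
Proof. by move=> [mF [s [M [C [_ _ hM _]]]]]; split => //; exists M. Qed.

Lemma lip_process_int t F b : 0 <= b -> lip_process t F ->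
  lip_cyl t (fun w => \int[lebesgue_measure]_(x in `[0, b]) F x w).
Proof.
move=> b0 hF; have mF w := lip_process_meas w hF.
move: hF => [_ [s [M [C [hs C0 hM hC]]]]].
have b00 : 0 <= (0 : R) <= b by rewrite lexx.
exists s, (b * M), (b * C); split => //; first by rewrite mulr_ge0.
  move=> w; rewrite int_oc0// -[X in X * M]subr0; exact: int_oc_norm_le.
move=> w w'; rewrite !int_oc0// -int_ocB// -mulrA -[X in X * _]subr0.
by apply: int_oc_norm_le => //; exact: meas_boundedB.
Qed.

Lemma lip_processB t F G :
  lip_process t F -> lip_process t G -> lip_process t (fun r w => F r w - G r w).
Proof.
move=> [mF [s [M [C [hs C0 hM hC]]]]] [mG [s' [M' [C' [hs' C0' hM' hC']]]]].
split; first by move=> w; exact: measurable_funB.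
exists (s ++ s'), (M + M'), (C + C'); split.
- by move=> u; rewrite mem_cat => /orP[/hs|/hs'].
- by rewrite addr_ge0.
- by move=> r w; rewrite (le_trans (ler_normB _ _))// lerD.
- move=> r w w'; rewrite path_dist_cat.
  have := hC r w w'; have := hC' r w w'.
  have := mulr_ge0 C0 (path_dist_ge0 s' w w').
  have := mulr_ge0 C0' (path_dist_ge0 s w w').
  rewrite mulrDl !mulrDr.
  have -> : F r w - G r w - (F r w' - G r w') = F r w - F r w' - (G r w - G r w').
    by lra.
  have := ler_normB (F r w - F r w') (G r w - G r w').
  by move: (C * _) (C * _) (C' * _) (C' * _) => *; lra.
Qed.

Lemma lip_process_norm t F : lip_process t F -> lip_process t (fun r w => `|F r w|).
Proof.
move=> [mF [s [M [C [hs C0 hM hC]]]]]; split.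
  by move=> w; exact: measurableT_comp.
exists s, M, C; split => //; first by move=> r w; rewrite normr_id.
by move=> r w w'; rewrite (le_trans (ler_dist_dist _ _)).
Qed.

Lemma lip_processN t F : lip_process t F -> lip_process t (fun r w => - F r w).
Proof.
move=> [mF [s [M [C [hs C0 hM hC]]]]]; split.
  by move=> w; exact: measurableT_comp.
exists s, M, C; split => //; first by move=> r w; rewrite normrN.
by move=> r w w'; rewrite -opprD normrN.
Qed.

Lemma lip_processD t F G :
  lip_process t F -> lip_process t G -> lip_process t (fun r w => F r w + G r w).
Proof.
move=> hF /lip_processN /(lip_processB hF).
by under [in X in X -> _]eq_fun do under eq_fun do rewrite opprK.
Qed.

Lemma lip_process_mul t f (c : R -> R) : measurable_fun setT c ->
  (forall r, `|c r| <= 1) -> lip_cyl t f -> lip_process t (fun r w => f w * c r).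
Proof.
move=> mc c1 [s [M [C [hs C0 hM hC]]]]; split.
  by move=> w; apply: measurable_funM => //; exact: measurable_cst.
exists s, M, C; split => //.
  by move=> r w; rewrite normrM -[M]mulr1 ler_pM.
move=> r w w'; rewrite -mulrBl normrM (le_trans _ (hC w w'))//.
by rewrite -[leRHS]mulr1 ler_wpM2l.
Qed.

Lemma simple_process_ind (P : (R -> path_space T -> R) -> Prop) :
  P (fun _ _ => 0) ->
  (forall F G, P F -> P G -> P (fun r w => F r w + G r w)) ->
  (forall a b xi, 0 <= a -> a <= b -> Lip_space a xi ->
     P (fun r w => xi w * \1_(`]a, b]) r)) ->
  forall eta, @simple_process R T eta -> P eta.
Proof.
move=> P0 PD P1 _ [N [t [xi [t0 _ tS hxi ->]]]].
have tge0 j : (j <= N)%N -> 0 <= t j.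
  elim: j => [|j IH] jN; first by rewrite t0.
  by rewrite (le_trans (IH (ltnW jN)))// ltW// tS.
suff : forall n, (n <= N)%N ->
    P (fun s w => \sum_(j < n) xi j w * \1_(`]t j, t j.+1]) s) by exact.
elim=> [_|n IH nN].
  by under eq_fun do under eq_fun do rewrite big_ord0.
under eq_fun do under eq_fun do rewrite big_ord_recr/=.
apply: PD; first exact/IH/ltnW.
by apply: P1; [exact/tge0/ltnW|exact/ltW/tS|exact: hxi].
Qed.

Lemma indic_norm_le1 (A : set R) r : `|\1_A r : R| <= 1.
Proof. by rewrite indicE; case: (_ \in _); rewrite ?normr1 ?normr0. Qed.

(** Adaptedness: on [0,t] only the terms that start before t contribute, and
these have coefficients that depend on the path up to t. *)
Lemma simple_process_restrict t eta : 0 <= t -> @simple_process R T eta ->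
  lip_process t (fun r w => eta r w * \1_(`[0, t]) r).
Proof.
move=> t0; move: eta; apply: simple_process_ind.
- apply: (lip_process_mul _ (indic_norm_le1 _) (lip_cyl_cst t 0)).
  exact: measurable_indic.
- move=> F G hF hG; under eq_fun do under eq_fun do rewrite mulrDl.
  exact: lip_processD.
- move=> a b xi a0 ab hxi.
  under eq_fun do under eq_fun do rewrite -mulrA.
  have mc : measurable_fun setT (fun r : R => \1_(`]a, b]) r * \1_(`[0, t]) r : R).
    by apply: measurable_funM; exact: measurable_indic.
  have c1 r : `|\1_(`]a, b]) r * \1_(`[0, t]) r : R| <= 1.
    by rewrite normrM mulr_ile1// indic_norm_le1.
  have [at_|ta] := leP a t.
    apply: (lip_process_mul mc c1); apply: lip_cyl_mono at_ _.
    exact/Lip_spaceP.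
  have -> : (fun r w => xi w * (\1_(`]a, b]) r * \1_(`[0, t]) r)) =
            (fun r w => 0 * (\1_(`]a, b]) r * \1_(`[0, t]) r)).
    apply/funext => r; apply/funext => w; rewrite mul0r !indicE !mem_setE !in_itv/=.
    have [ar|_] := ltP a r; last by rewrite mul0r mulr0.
    by rewrite (leNgt r t) (lt_trans ta ar) andbF !mulr0.
  exact: (lip_process_mul mc c1 (lip_cyl_cst t 0)).
Qed.

Lemma simple_process_bounds eta : @simple_process R T eta ->
  exists M V, forall w,
    [/\ forall r, `|eta r w| <= M, meas_bounded (eta^~ w) & oscillation_le V (eta^~ w)].
Proof.
suff hyp : @simple_process R T eta -> exists M V, forall w,
    [/\ forall r, `|eta r w| <= M, measurable_fun setT (eta^~ w) &
        oscillation_le V (eta^~ w)].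
  move=> /hyp[M [V h]]; exists M, V => w; have [hM hm hV] := h w.
  by split => //; split => //; exists M.
move: eta; apply: simple_process_ind.
- exists 0, 0 => w; split; [by move=> r; rewrite normr0|exact: measurable_cst|].
  move=> u n _; exists (fun=> 0); split; first by rewrite big1.
  by move=> i x y _ _; rewrite subrr normr0.
- move=> F G [M [V hF]] [M' [V' hG]]; exists (M + M'), (V + V') => w.
  have [h1 h2 h3] := hF w; have [k1 k2 k3] := hG w; split.
  + by move=> r; rewrite (le_trans (ler_normD _ _))// lerD.
  + exact: measurable_funD.
  + exact: oscillation_leD.
- move=> a b xi a0 ab /(Lip_spaceP _ a0)[s [M [C [_ _ hM _]]]].
  exists M, (2 * M) => w; split.
  + move=> r; rewrite normrM (le_trans _ (hM w))// -[leRHS]mulr1 ler_wpM2l//.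
    exact: indic_norm_le1.
  + by apply: measurable_funM; [exact: measurable_cst|exact: measurable_indic].
  + move=> u n hu; have [v [sv hv]] := oscillation_le_indic (xi w) ab n hu.
    by exists v; split => //; rewrite (le_trans sv)// ler_wpM2l.
Qed.

Lemma simple_process_meas eta w : @simple_process R T eta -> meas_bounded (eta^~ w).
Proof. by move=> /simple_process_bounds[M [V /(_ w)[]]]. Qed.

Lemma simple_process_int_adapted t eta : 0 <= t -> @simple_process R T eta ->
  lip_cyl t (fun w => \int[lebesgue_measure]_(x in `[0, t]) eta x w).
Proof.
move=> t0 heta.
have := lip_process_int t0 (simple_process_restrict t0 heta).
congr lip_cyl; apply/funext => w; apply: eq_Rintegral => x xt.
by rewrite indicE xt mulr1.
Qed.

Lemma simple_process_dist_cyl eta eta' : 0 <= T ->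
  @simple_process R T eta -> @simple_process R T eta' ->
  lip_cyl T (fun w => \int[lebesgue_measure]_(x in `[0, T]) `|eta x w - eta' x w|).
Proof.
move=> T0 heta heta'.
have := lip_process_int T0 (lip_process_norm (lip_processB
  (simple_process_restrict T0 heta) (simple_process_restrict T0 heta'))).
congr lip_cyl; apply/funext => w; apply: eq_Rintegral => x xT.
by rewrite indicE xT !mulr1.
Qed.

Lemma simple_process_M1_const (c : R) k : 0 < T -> @simple_process R T (M1_const T c k).
Proof.
move=> T0; exists 1%N, (fun i => if i is 0 then 0 else T), (fun _ _ => c); split => //.
- by case.
- by case=> // _; apply/(Lip_spaceP _ (lexx 0)); exact: lip_cyl_cst.
- by apply/funext => s; apply/funext => w; rewrite big_ord1.
Qed.

End SimpleProcess.

(** * Expectations of increments *)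

Section Truncation.
Context {R : realType}.
Implicit Types x y k : R.

Definition trunc_dist k x y : R := Num.min `|x - y| k.

Lemma trunc_dist_ge0 k x y : 0 <= k -> 0 <= trunc_dist k x y.
Proof. by move=> k0; rewrite le_min normr_ge0. Qed.

Lemma trunc_dist_norm_le k x y : 0 <= k -> `|trunc_dist k x y| <= k.
Proof. by move=> k0; rewrite ger0_norm ?trunc_dist_ge0// ge_min lexx orbT. Qed.

Lemma trunc_dist_le k x y : trunc_dist k x y <= `|x - y|.
Proof. by rewrite ge_min lexx. Qed.

Lemma trunc_dist_le_dist k x y x' y' :
  trunc_dist k x y <= trunc_dist k x' y' + (`|x - x'| + `|y - y'|).
Proof.
have h : `|x - y| <= `|x' - y'| + (`|x - x'| + `|y - y'|).
  rewrite (le_trans (ler_distD x' _ _))//.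
  have := ler_distD y' x' y; rewrite (distrC y' y); lra.
have h' : 0 <= `|x - x'| + `|y - y'| by rewrite addr_ge0.
rewrite /trunc_dist /Num.min.
by case: (ltP `|x - y|) => ?; case: (ltP `|x' - y'|) => ?; lra.
Qed.

Lemma trunc_dist_lip k x y x' y' :
  `|trunc_dist k x y - trunc_dist k x' y'| <= `|x - x'| + `|y - y'|.
Proof.
rewrite ler_distlC; have := trunc_dist_le_dist k x' y' x y.
have := trunc_dist_le_dist k x y x' y'; rewrite (distrC x') (distrC y').
by move=> *; apply/andP; split; lra.
Qed.

(** The projection onto [-B, B] fixes x and is 1-Lipschitz, and two points of
[-B, B] are at distance at most 2 B. *)
Lemma dist_clip_le (B x y : R) : `|x| <= B ->
  `|x - Num.max (- B) (Num.min y B)| <= trunc_dist (2 * B) y x.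
Proof.
rewrite ler_norml => /andP[h1 h2]; rewrite le_min.
have [h|h] : Num.min y B = y /\ y <= B \/ Num.min y B = B /\ B <= y.
- by case: (leP y B) => h; [left|right]; split => //; exact: ltW.
- case: h => -> yB; rewrite /Num.max; case: (ltP (- B) y) => h;
  by rewrite (distrC y) !ler_norml; case: (leP 0 (x - y)) => h0;
    rewrite ?(ger0_norm h0) ?(ltr0_norm h0); apply/andP; split; try (apply/andP; split); lra.
- case: h => -> yB; rewrite /Num.max; case: (ltP (- B) B) => h;
  by rewrite (distrC y) !ler_norml; case: (leP 0 (x - y)) => h0;
    rewrite ?(ger0_norm h0) ?(ltr0_norm h0); apply/andP; split; try (apply/andP; split); lra.
Qed.

End Truncation.

Section GExpectation.
Context {R : realType} {T : R} {E : (path_space T -> R) -> R}.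
Hypothesis T0 : 0 < T.
Hypothesis hE : sublinear_expectation (cyl_space T) E.
Implicit Types (eta : R -> path_space T -> R) (w : path_space T).

Local Notation simple := (@simple_process R T).
Local Notation M1 eta eta' := (M1_norm E (eta - eta')).

Lemma lip_cylT_cyl t (f : path_space T -> R) : t <= T -> lip_cyl t f -> cyl_space T f.
Proof. by move=> tT /(lip_cyl_mono tT)/(Lip_spaceP _ (ltW T0))/cyl_Lip. Qed.

Definition process_int eta a b w : R := int_oc (eta^~ w) a b.

Lemma process_int_cyl eta a b : 0 <= a -> a <= b -> simple eta ->
  lip_cyl b (process_int eta a b).
Proof.
move=> a0 ab heta; apply: lip_cylB.
  exact: simple_process_int_adapted (le_trans a0 ab) heta.
by apply: lip_cyl_mono ab _; exact: simple_process_int_adapted.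
Qed.

(** M1_norm E (eta - eta') is convertible to E (path_L1_dist eta eta'). *)
Definition path_L1_dist eta eta' w : R :=
  \int[lebesgue_measure]_(x in `[0, T]) `|(eta - eta') x w|.

Lemma path_L1_dist_cyl eta eta' : simple eta -> simple eta' ->
  cyl_space T (path_L1_dist eta eta').
Proof.
by move=> h h'; apply: lip_cylT_cyl (lexx T) _; exact: simple_process_dist_cyl (ltW T0) h h'.
Qed.

Lemma path_L1_dist_meas eta eta' w : simple eta -> simple eta' ->
  meas_bounded (fun x => `|eta x w - eta' x w|).
Proof. by move=> h h'; apply/meas_bounded_norm/meas_boundedB; exact: simple_process_meas. Qed.

Lemma path_L1_distE eta eta' w : simple eta -> simple eta' ->
  path_L1_dist eta eta' w = int_oc (fun x => `|eta x w - eta' x w|) 0 T.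
Proof. by move=> h h'; rewrite /path_L1_dist int_oc0//; exact: path_L1_dist_meas. Qed.

Lemma sum_process_int_dist eta eta' (u : nat -> R) n w :
  simple eta -> simple eta' -> 0 <= u 0%N -> (forall i, u i <= u i.+1) -> u n <= T ->
  \sum_(i < n) `|process_int eta (u i) (u i.+1) w - process_int eta' (u i) (u i.+1) w|
    <= path_L1_dist eta eta' w.
Proof.
move=> h h' u0 uS un; rewrite path_L1_distE//.
have hm := path_L1_dist_meas w h h'.
have uge i : 0 <= u i by elim: i => // i IH; rewrite (le_trans IH).
have ge0 a b : 0 <= a <= b -> 0 <= int_oc (fun x => `|eta x w - eta' x w|) a b.
  move=> ab; rewrite -[X in X <= _](mulr0 (b - a)) -int_oc_cst//.
  by apply: int_oc_le => //; exact: meas_bounded_cst.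
rewrite -(int_oc_chain _ 0 (u 0%N)) -(int_oc_chain _ (u 0%N) (u n)) -sum_int_oc.
rewrite addrCA ler_wpDr//.
  by rewrite addr_ge0// ge0// ?lexx ?u0 ?uge.
apply: ler_sum => i _; rewrite -int_ocB; try exact: simple_process_meas.
by apply: int_oc_norm; rewrite ?uge ?uS//; apply: meas_boundedB; exact: simple_process_meas.
Qed.

Lemma process_int_dist eta eta' a b w : simple eta -> simple eta' ->
  0 <= a -> a <= b -> b <= T ->
  `|process_int eta a b w - process_int eta' a b w| <= path_L1_dist eta eta' w.
Proof.
move=> h h' a0 ab bT.
have := @sum_process_int_dist eta eta' (fun i => if i is 0 then a else b) 1 w h h' a0.
by rewrite big_ord1; apply => //; case.
Qed.

Lemma M1_triangle eta1 eta2 eta3 : simple eta1 -> simple eta2 -> simple eta3 ->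
  M1 eta1 eta3 <= M1 eta1 eta2 + M1 eta2 eta3.
Proof.
move=> h1 h2 h3.
have c12 := path_L1_dist_cyl h1 h2; have c23 := path_L1_dist_cyl h2 h3.
apply: (le_trans _ (sle_leD hE c12 c23)).
apply: (sle_mono hE); [exact: path_L1_dist_cyl|exact: (sle_add hE c12 c23)|].
move=> w; rewrite -/(path_L1_dist eta1 eta3 w) !path_L1_distE//.
have m12 := path_L1_dist_meas w h1 h2; have m23 := path_L1_dist_meas w h2 h3.
rewrite -lerBlDr -int_ocB//; last exact: path_L1_dist_meas.
apply: int_oc_le => //; first by rewrite lexx ltW.
  by apply: meas_boundedB => //; exact: path_L1_dist_meas.
by move=> x _; rewrite lerBlDr ler_distD.
Qed.

Lemma expectation_dist_M1 (f f' : path_space T -> R) eta eta' :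
  simple eta -> simple eta' -> cyl_space T f -> cyl_space T f' ->
  (forall w, `|f w - f' w| <= path_L1_dist eta eta' w) ->
  `|E f - E f'| <= M1 eta eta'.
Proof.
move=> h h' hf hf' ff'; apply: (le_trans (sle_dist hE hf hf')).
apply: (sle_mono hE) => //; last exact: path_L1_dist_cyl.
exact/(sle_norm hE)/(sle_sub hE).
Qed.

Section CauchySequence.
Context {h : nat -> R -> path_space T -> R}.
Hypothesis hh : M1G E h.

Lemma M1G_simple k : simple (h k).
Proof. by case: hh. Qed.

Lemma M1G_cauchy (e : R) : 0 < e -> exists K, forall k l,
  (K <= k)%N -> (K <= l)%N -> M1 (h k) (h l) <= e.
Proof.
move=> /(proj2 hh)[K hK]; exists K => k l kK lK; exact/ltW/hK.
Qed.

Lemma M1G_cvg (a : nat -> R) :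
  (forall k l, `|a k - a l| <= M1 (h k) (h l)) -> cvgn a.
Proof.
move=> ha; apply/cauchy_cvgP/cauchy_ballP => e e0; near_simpl.
have [K hK] := M1G_cauchy (divr_gt0 e0 (ltr0n R 2)).
exists ([set n | (K <= n)%N], [set n | (K <= n)%N]).
  by split; exists K.
move=> [k l] [/= kK lK]; rewrite /ball/= (le_lt_trans (ha _ _))//.
by rewrite (le_lt_trans (hK _ _ kK lK))//; lra.
Qed.

Lemma M1G_limn_dist (a : nat -> R) k (e : R) :
  (forall k l, `|a k - a l| <= M1 (h k) (h l)) ->
  (forall l, (k <= l)%N -> M1 (h k) (h l) <= e) -> `|a k - limn a| <= e.
Proof.
move=> ha he; have ca := M1G_cvg ha.
rewrite ler_distl; apply/andP; split.
  rewrite lerBlDr; apply: limr_le => //; near=> l.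
  have kl : (k <= l)%N by near: l; exact: nbhs_infty_ge.
  by have := le_trans (ha k l) (he l kl); rewrite ler_distl lerBlDr => /andP[].
rewrite -lerBlDr; apply: limr_ge => //; near=> l.
have kl : (k <= l)%N by near: l; exact: nbhs_infty_ge.
by have := le_trans (ha k l) (he l kl); rewrite ler_distl -lerBlDr => /andP[].
Unshelve. all: by end_near. Qed.

End CauchySequence.
End GExpectation.

Section IndependentIncrements.
Context {R : realType} {T : R} {E : (path_space T -> R) -> R}.
Context {h : nat -> R -> path_space T -> R}.
Hypothesis T0 : 0 < T.
Hypothesis hE : sublinear_expectation (cyl_space T) E.
Hypothesis hh : M1G E h.
Implicit Types (w : path_space T) (k : nat) (kap : R).

Local Notation M1 eta eta' := (M1_norm E (eta - eta')).

Lemma trunc_dist_cyl kap t (f g : path_space T -> R) :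
  lip_cyl t f -> lip_cyl t g -> lip_cyl t (fun w => trunc_dist kap (f w) (g w)).
Proof.
apply: (@lip_cyl_comp2 _ _ _ _ _ (trunc_dist kap) 1) => a b a' b'.
by rewrite mul1r trunc_dist_lip.
Qed.

(** The truncated distance in mean between y and the increment over ]a, b] of
the integral of the element of M^1 represented by h. *)
Definition mean_dist kap a b (y : R) : R :=
  limn (fun l => E (fun w => trunc_dist kap y (process_int (h l) a b w))).

(** Such a family of expectations, indexed by the approximating sequence, is
Cauchy at the rate of the sequence itself, because the increment changes by at
most the L^1 distance of the two paths of the integrand. *)
Lemma trunc_dist_incr_M1 kap a b (zeta eta : path_space T -> R) :
  0 <= a -> a <= b -> b <= T -> lip_cyl T zeta -> lip_cyl T eta ->
  forall k l, `|E (fun w => zeta w + trunc_dist kap (eta w) (process_int (h k) a b w)) -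
    E (fun w => zeta w + trunc_dist kap (eta w) (process_int (h l) a b w))| <=
  M1 (h k) (h l).
Proof.
move=> a0 ab bT hz he.
have hc k : cyl_space T (fun w => zeta w + trunc_dist kap (eta w) (process_int (h k) a b w)).
  apply: (lip_cylT_cyl T0 (lexx T)); apply: lip_cylD => //; apply: trunc_dist_cyl => //.
  by apply: lip_cyl_mono bT _; apply: process_int_cyl => //; exact: (M1G_simple hh).
move=> k l; apply: expectation_dist_M1 => //; try exact: (M1G_simple hh).
move=> w; rewrite opprD addrACA subrr add0r (le_trans (trunc_dist_lip _ _ _ _ _))//.
by rewrite subrr normr0 add0r process_int_dist//; exact: (M1G_simple hh).
Qed.

Lemma trunc_dist_cst_M1 kap a b (y : R) :
  0 <= a -> a <= b -> b <= T ->
  forall k l, `|E (fun w => trunc_dist kap y (process_int (h k) a b w)) -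
    E (fun w => trunc_dist kap y (process_int (h l) a b w))| <= M1 (h k) (h l).
Proof.
move=> a0 ab bT k l.
have := trunc_dist_incr_M1 kap a0 ab bT (lip_cyl_cst T 0) (lip_cyl_cst T y) k l.
by congr (`|E _ - E _| <= _); apply/funext => w; rewrite add0r.
Qed.

Lemma trunc_dist_cst_cyl kap a b (y : R) k : 0 <= a -> a <= b -> b <= T ->
  cyl_space T (fun w => trunc_dist kap y (process_int (h k) a b w)).
Proof.
move=> a0 ab bT; apply: (lip_cylT_cyl T0 bT); apply: trunc_dist_cyl.
  exact: lip_cyl_cst.
by apply: process_int_cyl => //; exact: (M1G_simple hh).
Qed.

Lemma mean_dist_lip kap a b (y z : R) : 0 <= a -> a <= b -> b <= T ->
  `|mean_dist kap a b y - mean_dist kap a b z| <= `|y - z|.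
Proof.
move=> a0 ab bT.
have cv x := M1G_cvg hh (trunc_dist_cst_M1 kap x a0 ab bT).
have key x x' : mean_dist kap a b x <= mean_dist kap a b x' + `|x - x'|.
  have cd : (fun l => E (fun w => trunc_dist kap x' (process_int (h l) a b w)) + `|x - x'|)
      @ \oo --> mean_dist kap a b x' + `|x - x'|.
    by apply: cvgD; [exact: cv|exact: cvg_cst].
  rewrite -(cvg_lim _ cd)//; apply: ler_lim; [exact: cv|by apply/cvg_ex; eexists; exact: cd|].
  near=> l; have hc z := trunc_dist_cst_cyl kap z l a0 ab bT.
  rewrite -(sle_Dcst hE _ (hc x')); apply: (sle_mono hE) => //.
    exact: (sle_add hE (hc x') (sle_cst hE _)).
  move=> w; rewrite (le_trans (trunc_dist_le_dist _ _ _ x' (process_int (h l) a b w)))//.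
  by rewrite subrr normr0 addr0.
by rewrite ler_distl lerBlDr key andbT distrC key.
Unshelve. all: by end_near. Qed.

(** Given the past, the increment Y over ]a, b] still has its full law, so the
conditional expectation of the truncated |eta - Y| is mean_dist evaluated at
eta, hence at least r whatever the value of eta. *)
Lemma indep_expectation_ge kap s a b r (zeta eta : path_space T -> R) :
  independent_increments E (integral_process h) ->
  0 <= kap -> 0 < s < T -> s <= a -> a <= b -> b <= T ->
  lip_cyl s zeta -> lip_cyl s eta -> (forall y, r <= mean_dist kap a b y) ->
  E zeta + r <=
  limn (fun l => E (fun w => zeta w + trunc_dist kap (eta w) (process_int (h l) a b w))).
Proof.
move=> [_ hind] k0 /andP[s0 sT] sa ab bT hz he hr.
have a0 : 0 <= a := le_trans (ltW s0) sa.
have sT' := ltW sT.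
set L := limn _.
(* the right-hand side is the inner expectation of the independence formula *)
suff -> : L = E (fun w => zeta w + mean_dist kap a b (eta w)).
  rewrite -(sle_Dcst hE); last exact: (lip_cylT_cyl T0 sT').
  apply: (sle_mono hE).
  - by apply: (lip_cylT_cyl T0 sT'); apply: lip_cylD => //; exact: lip_cyl_cst.
  - apply: (lip_cylT_cyl T0 sT').
    apply: (@lip_cyl_comp2 _ _ _ _ _ (fun x y => x + mean_dist kap a b y) 1) => //.
    move=> x y x' y'; rewrite mul1r opprD addrACA (le_trans (ler_normD _ _))//.
    by rewrite lerD2l mean_dist_lip.
  - by move=> w; rewrite lerD2l.
have hz' := hz; have he' := he.
move: hz' he' => [s1 [M1' [C1 [hs1 C10 hM1 hC1]]]] [s2 [M2 [C2 [hs2 C20 hM2 hC2]]]].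
have hs12 : {in s1 ++ s2, forall u, 0 <= u <= s}.
  by move=> u; rewrite mem_cat => /orP[/hs1|/hs2].
have [m [v [C [C0 v0 vS vm hC]]]] := @path_dist_increments R T _ _ (ltW s0) hs12.
(* the joint functional of path and increment, as a test function of p *)
pose p (x : path_space T * R) : 'rV_(m + 1) :=
  row_mx (increments m v x.1) (\row_(i < 1) x.2).
pose F (x : path_space T * R) := zeta x.1 + trunc_dist kap (eta x.1) x.2.
have pl x y : `|increments m v x.1 - increments m v y.1| <= `|p x - p y|.
  apply: rV_norm_le => // i; have := rV_coord_le (p x - p y) (lshift 1 i).
  by rewrite opp_row_mx add_row_mx row_mxEl.
have pr x y : `|x.2 - y.2| <= `|p x - p y|.
  have := rV_coord_le (p x - p y) (rshift m 0).
  by rewrite opp_row_mx add_row_mx row_mxEr !mxE.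
have [| | |phi [hphi phiE]] := @CbLip_extension R _ _ p F (M1' + kap) (C1 * C + C2 * C + 1).
- by rewrite !addr_ge0// mulr_ge0.
- move=> x; rewrite (le_trans (ler_normD _ _))// lerD//.
  exact: trunc_dist_norm_le.
- move=> x y.
  have hCC := le_trans (hC x.1 y.1) (ler_wpM2l C0 (pl x y)).
  rewrite path_dist_cat in hCC.
  have d1 : path_dist s1 x.1 y.1 <= C * `|p x - p y|.
    by rewrite (le_trans _ hCC)// lerDl path_dist_ge0.
  have d2 : path_dist s2 x.1 y.1 <= C * `|p x - p y|.
    by rewrite (le_trans _ hCC)// lerDr path_dist_ge0.
  have e1 := le_trans (hC1 x.1 y.1) (ler_wpM2l C10 d1).
  have e2 := le_trans (hC2 x.1 y.1) (ler_wpM2l C20 d2).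
  rewrite /F opprD addrACA (le_trans (ler_normD _ _))// !mulrDl mul1r -!mulrA -addrA.
  by rewrite lerD// (le_trans (trunc_dist_lip _ _ _ _ _))// lerD.
pose u (j : nat) : R := if j is 0 then a else b.
have pE l w w' : row_mx (\row_(i < m) (Bproc (v i.+1) w - Bproc (v i) w))
    (\row_(i < 1) (integral_process h (u i.+1) l w' - integral_process h (u i) l w')) =
    p (w, process_int (h l) a b w').
  by congr row_mx; apply/rowP => i; rewrite !mxE ord1.
have uS i : (i < 1)%N -> u i <= u i.+1 by case: i.
have v00 : 0 <= v 0%N by rewrite v0.
have s0T : 0 < s < T by rewrite s0.
have := hind s m 1%N v u s0T v00 vS vm sa uS bT phi hphi.
rewrite /Eext => H.
rewrite {}/L.
transitivity (limn (fun l => E (fun w => phi (p (w, process_int (h l) a b w))))).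
  by congr (limn _); apply/funext => l; congr E; apply/funext => w; rewrite phiE.
transitivity (limn (fun k : nat => E (fun w => limn (fun l => E (fun w' =>
    phi (p (w, process_int (h l) a b w'))))))).
  transitivity (limn (fun l => E (fun w =>
      phi (row_mx (\row_(i < m) (Bproc (v i.+1) w - Bproc (v i) w))
        (\row_(i < 1) (integral_process h (u i.+1) l w - integral_process h (u i) l w)))))).
    by congr (limn _); apply/funext => l; congr E; apply/funext => w; rewrite pE.
  rewrite H; congr (limn _); apply/funext => _; congr E; apply/funext => w.
  by congr (limn _); apply/funext => l; congr E; apply/funext => w'; rewrite pE.
rewrite lim_cst//; congr E; apply/funext => w.
apply/cvg_lim => //.
have -> : (fun l => E (fun w' => phi (p (w, process_int (h l) a b w')))) =
   (fun l => zeta w + E (fun w' => trunc_dist kap (eta w) (process_int (h l) a b w'))).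
  apply/funext => l; rewrite addrC -(sle_Dcst hE); last exact: trunc_dist_cst_cyl.
  by congr E; apply/funext => w'; rewrite phiE addrC.
apply: cvgD; first exact: cvg_cst.
exact: (M1G_cvg hh (trunc_dist_cst_M1 kap (eta w) a0 ab bT)).
Qed.

End IndependentIncrements.

(** * Approximation by constants *)

Lemma sum_pairs (R : realType) (f : nat -> R) p :
  \sum_(j < p.*2) f j = \sum_(i < p) (f i.*2 + f i.*2.+1).
Proof.
elim: p => [|p IH]; first by rewrite !big_ord0.
by rewrite doubleS !big_ord_recr/= IH addrA.
Qed.

Section Constant.
Context {R : realType} {T : R} {E : (path_space T -> R) -> R}.
Context {h : nat -> R -> path_space T -> R}.
Hypothesis T0 : 0 < T.
Hypothesis hE : sublinear_expectation (cyl_space T) E.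
Hypothesis hh : M1G E h.
Hypothesis hstat : stationary_increments E (integral_process h).
Hypothesis hindep : independent_increments E (integral_process h).

Local Notation M1 eta eta' := (M1_norm E (eta - eta')).

Lemma mean_dist_stationary kap d r y :
  0 <= kap -> 0 <= d -> 0 <= r -> d + r <= T ->
  mean_dist (E := E) (h := h) kap r (d + r) y = mean_dist (E := E) (h := h) kap 0 d y.
Proof.
move=> k0 d0 r0 drT.
have hphi : CbLip (fun x : 'rV[R]_1 => trunc_dist kap y (x 0 0)).
  split; first by exists kap => x; exact: trunc_dist_norm_le.
  exists 1 => x x'; rewrite mul1r (le_trans (trunc_dist_lip _ _ _ _ _))//.
  rewrite subrr normr0 add0r; have := rV_coord_le (x - x') 0; by rewrite !mxE.
have := hstat (lexx 0) d0 r0 drT hphi; rewrite add0r.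
by congr (limn _ = limn _); apply/funext => l; congr E; apply/funext => w; rewrite !mxE.
Qed.

(** The double estimate of p r: from below by independence, from above by
comparing consecutive cells of a simple approximation g. The grid is chosen
after g, so that the variation of g contributes little, and the index k of a
second approximation h k after the grid, so that its error is small even when
summed over all cells. *)
Lemma M1G_near_const (eps : R) : 0 < eps ->
  exists K x, forall k, (K <= k)%N -> M1 (h k) (M1_const T x 0) <= eps.
Proof.
(* 10 e between g and the constant, and e between g and any later h l *)
move=> eps0; pose e := eps / 11.
have e0 : 0 < e by rewrite divr_gt0// ltr0n.
have hs k : @simple_process R T (h k) := M1G_simple hh k.
have [K hK] := M1G_cauchy hh e0.
pose g := h K; have gs : @simple_process R T g := hs K.
have [M [V gb]] := simple_process_bounds (hs K).
pose B := `|M|.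
have gB x w : `|g x w| <= B by have [h1 _ _] := gb w; rewrite (le_trans (h1 x))// ler_norm.
have gm w : meas_bounded (g^~ w) by have [] := gb w.
have gV w : oscillation_le V (g^~ w) by have [] := gb w.
(* the variation of g enters with weight 4 d V in Iy and 2 d V in gx *)
have [p p0 hp] : exists2 p, (0 < p)%N & 6 * (T / p.*2%:R) * V <= e.
  pose x := 3 * T * `|V| / e.
  have x0 : 0 <= x by rewrite divr_ge0 ?mulr_ge0// ltW.
  exists (Num.bound x) => //.
  have hx := archi_boundP x0; set p := Num.bound x in hx *.
  have p0 : 0 < p%:R :> R by rewrite (le_lt_trans x0).
  have -> : 6 * (T / p.*2%:R) * V = 3 * T * V / p%:R.
    by rewrite -muln2 natrM; field; rewrite gt_eqF.
  rewrite ler_pdivrMr//.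
  apply: (@le_trans _ _ (3 * T * `|V|)); first by rewrite ler_wpM2l ?ler_norm// mulr_ge0// ltW.
  by rewrite (mulrC e) -ler_pdivrMr// ltW.
pose d := T / p.*2%:R.
have n0 : 0 < p.*2%:R :> R by rewrite ltr0n double_gt0.
have d0 : 0 < d by rewrite divr_gt0.
have dn : d * p.*2%:R = T by rewrite /d divfK// gt_eqF.
pose u j := d * j%:R.
have u0 : u 0%N = 0 by rewrite /u mulr0.
have uSE j : u j.+1 = d + u j by rewrite /u -natr1 mulrDr mulr1 addrC.
have uS j : u j <= u j.+1 by rewrite uSE lerDr ltW.
have uge j : 0 <= u j by rewrite mulr_ge0// ltW.
have uT j : (j <= p.*2)%N -> u j <= T by move=> jp; rewrite -dn ler_wpM2l ?ler_nat// ltW.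
pose I k j w := process_int (h k) (u j) (u j.+1) w.
pose kap := 2 * (d * B).
have kap0 : 0 <= kap by apply: mulr_ge0 => //; apply: mulr_ge0; [exact: ltW|exact: normr_ge0].
have pR : 0 < p%:R :> R by rewrite ltr0n.
have [K' hK'] := M1G_cauchy hh (divr_gt0 e0 pR).
pose k := maxn K K'.
have hk l : (k <= l)%N -> M1 (h k) (h l) <= e / p%:R.
  by move=> kl; apply: hK'; rewrite ?leq_maxr// (leq_trans (leq_maxr K K')).
pose rho := mean_dist (E := E) (h := h) kap 0 d.
have rhoE j y : (j < p.*2)%N -> mean_dist (E := E) (h := h) kap (u j) (u j.+1) y = rho y.
  move=> jp; rewrite uSE; apply: mean_dist_stationary => //; first exact: ltW.
  by rewrite -uSE uT.
have rho_ge0 y : 0 <= rho y.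
  have dT : d <= T by rewrite -[d]mulr1 -[1]/(1%:R) uT// double_gt0.
  apply: limr_ge.
    exact: (M1G_cvg hh (trunc_dist_cst_M1 T0 hE hh kap y (lexx 0) (ltW d0) dT)).
  near=> l; rewrite -[X in X <= _](sle_const hE 0); apply: (sle_mono hE); first exact: (sle_cst hE).
    exact: (trunc_dist_cst_cyl T0 hh kap y l (lexx 0) (ltW d0) dT).
  by move=> w; exact: trunc_dist_ge0.
pose r := inf (range rho).
have rr y : r <= rho y by apply: ge_inf; [exists 0 => _ [z _ <-]|exists y].
have Icyl l j : lip_cyl (u j.+1) (I l j) by apply: process_int_cyl.
pose S m w := \sum_(i < m) trunc_dist kap (I k i.*2 w) (I k i.*2.+1 w).
have Scyl m : lip_cyl (u m.*2) (S m).
  apply: lip_cyl_sum => i; apply: trunc_dist_cyl; apply: lip_cyl_mono (Icyl _ _);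
  by rewrite ler_wpM2l ?(ltW d0)// ler_nat -?doubleS ?leq_double// ltnW// -doubleS leq_double.
(* the increment over the second cell of the last pair is independent of the
   path up to the start of that cell, on which the other increments depend *)
have lower m : (m <= p)%N -> m%:R * (r - e / p%:R) <= E (S m).
  elim: m => [_|m IH mp].
    rewrite mul0r (_ : S 0%N = fun=> 0) ?(sle_const hE)//.
    by apply/funext => w; rewrite /S big_ord0.
  have mp2 : (m.*2.+1 < p.*2)%N by rewrite -doubleS leq_double.
  have SE : S m.+1 = fun w => S m w + trunc_dist kap (I k m.*2 w) (I k m.*2.+1 w).
    by apply/funext => w; rewrite /S big_ord_recr.
  have sT : 0 < u m.*2.+1 < T.
    apply/andP; split; first exact: (mulr_gt0 d0 (ltr0Sn _ _)).
    by rewrite -[ltRHS]dn /u ltr_pM2l// ltr_nat.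
  have lo := indep_expectation_ge T0 hE hh hindep kap0 sT (lexx _) (uS _) (uT _ mp2)
    (lip_cyl_mono (uS m.*2) (Scyl m)) (Icyl k m.*2) (r := r).
  have {}/lo : forall y, r <= mean_dist (E := E) (h := h) kap (u m.*2.+1) (u m.*2.+2) y.
    by move=> y; rewrite rhoE.
  have zT : lip_cyl T (S m) by apply: lip_cyl_mono (Scyl m); apply: uT; rewrite leq_double ltnW.
  have iT : lip_cyl T (I k m.*2) by apply: lip_cyl_mono (Icyl k m.*2); exact/uT/ltnW.
  have := M1G_limn_dist hh (trunc_dist_incr_M1 T0 hE hh kap (uge _) (uS _) (uT _ mp2) zT iT) hk.
  rewrite SE -/(I k m.*2.+1); set L := limn _ => hL hl.
  rewrite -natr1 mulrDl mul1r; have := IH (ltnW mp).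
  move: hL; rewrite ler_distl => /andP[hL _] hS.
  have : L <= E (fun w => S m w + trunc_dist kap (I k m.*2 w) (I k m.*2.+1 w)) + e / p%:R.
    by rewrite -lerBlDr.
  lra.
have gk : M1 (h k) g <= e by rewrite hK// leq_maxl.
have dist_gk := path_L1_dist_cyl T0 (hs k) (hs K).
have cells w : \sum_(j < p.*2) `|I k j w - I K j w| <= path_L1_dist (h k) g w.
  by apply: (sum_process_int_dist w (hs k) (hs K)); rewrite ?u0 ?uT.
have upper : E (S p) <= 2 * d * V + e.
  have SC : cyl_space T (S p) by apply: (lip_cylT_cyl T0 _ (Scyl p)); exact: uT.
  apply: (@le_trans _ _ (E (fun w => path_L1_dist (h k) g w + 2 * d * V))).
    apply: (sle_mono hE) => //; first exact: (sle_add hE dist_gk (sle_cst hE _)).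
    move=> w; rewrite addrC.
    have := sum_int_oc_consecutive p (ltW d0) (gV w) (gm w).
    have := cells w; rewrite (sum_pairs (fun j => `|I k j w - I K j w|)) => hw1 hw2.
    apply: (le_trans _ (lerD hw2 hw1)); rewrite -big_split/=; apply: ler_sum => i _.
    rewrite (le_trans (trunc_dist_le_dist _ _ _ (I K i.*2 w) (I K i.*2.+1 w)))//.
    by rewrite lerD2r trunc_dist_le.
  by rewrite (sle_Dcst hE)// addrC lerD2l.
have pr : p%:R * r <= 2 * d * V + 2 * e.
  have := le_trans (lower p (leqnn p)) upper.
  by rewrite mulrBr mulrCA divff ?gt_eqF// mulr1; lra.
have [_ [y _ <-] hy] : exists2 z, range rho z & z < r + e / p%:R.
  apply: inf_adherent; first exact: divr_gt0.
  by split; [exists (rho 0), 0|exists 0 => _ [z _ <-]].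
have Iy : E (fun w => \sum_(j < p.*2) trunc_dist kap y (I k j w)) <= 4 * d * V + 8 * e.
  apply: (@le_trans _ _ (\sum_(j < p.*2) (r + 2 * (e / p%:R)))).
    apply: (sle_sum_le hE) => j.
      exact: (trunc_dist_cst_cyl T0 hh kap y k (uge _) (uS _) (uT _ (ltn_ord j))).
    have := M1G_limn_dist hh
      (trunc_dist_cst_M1 T0 hE hh kap y (uge j) (uS j) (uT _ (ltn_ord j))) hk.
    have := rhoE j y (ltn_ord j); rewrite /mean_dist => ->.
    by rewrite ler_distl => /andP[_]; lra.
  rewrite sumr_const card_ord -[leLHS]mulr_natl -muln2 natrM.
  have -> : p%:R * 2 * (r + 2 * (e / p%:R)) = 2 * (p%:R * r) + 4 * e.
    by field; rewrite gt_eqF.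
  by lra.
have ccyl j : (j < p.*2)%N -> cyl_space T (fun w => trunc_dist kap y (I k j w)).
  by move=> jp; exact: (trunc_dist_cst_cyl T0 hh kap y k (uge _) (uS _) (uT _ jp)).
have c1 := sle_sum hE (fun j => ccyl _ (ltn_ord j)).
(* y / d, projected onto the interval [-B, B] in which g takes its values *)
pose x := Num.max (- B) (Num.min (y / d) B).
have cx := simple_process_M1_const x 0 T0.
have gx : M1 g (M1_const T x 0) <= 10 * e.
  apply: (@le_trans _ _ (E (fun w => \sum_(j < p.*2) trunc_dist kap y (I k j w) +
      path_L1_dist (h k) g w + 2 * d * V))).
    apply: (sle_mono hE).
    - exact: (path_L1_dist_cyl T0 (hs K) cx).
    - exact: (sle_add hE (sle_add hE c1 dist_gk) (sle_cst hE _)).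
    - move=> w; rewrite -/(path_L1_dist g (M1_const T x 0) w) path_L1_distE//.
      have := int_oc_dist_cst (f := g^~ w) x p.*2 (ltW d0) (gV w) (gm w).
      rewrite dn => hw.
      apply: (@le_trans _ _ (int_oc (fun s => `|g s w - x|) 0 T)).
        apply: int_oc_le => //; first by rewrite lexx ltW.
          exact: (path_L1_dist_meas w (hs K) cx).
          by apply/meas_bounded_norm/meas_boundedB => //; exact: meas_bounded_cst.
        move=> s /andP[s0 sT]; rewrite /M1_const indicE mem_set ?mulr1//=.
        by rewrite in_itv/= s0 sT.
      apply: (le_trans hw); rewrite lerD2r.
      apply: (le_trans _ (lerD (lexx _) (cells w))); rewrite -big_split/=.
      apply: ler_sum => j _; rewrite -/(u j) -/(u j.+1).
      rewrite -/(process_int g (u j) (u j.+1) w) -/(I K j w).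
      have IB : `|I K j w| <= d * B.
        have -> : d = u j.+1 - u j by rewrite uSE addrK.
        by apply: int_oc_norm_le => //; rewrite uge uS.
      have dx : d * x = Num.max (- (d * B)) (Num.min y (d * B)).
        rewrite /x maxr_pMr ?ltW// minr_pMr ?ltW// mulrN.
        by rewrite mulrCA divff ?mulr1// gt_eqF.
      rewrite dx (le_trans (dist_clip_le y IB))//.
      rewrite (le_trans (trunc_dist_le_dist _ _ _ y (I k j w)))//.
      by rewrite subrr normr0 add0r (distrC (I K j w)).
  rewrite (sle_Dcst hE); last exact: (sle_add hE c1 dist_gk).
  have := sle_leD hE c1 dist_gk.
  have : E (path_L1_dist (h k) g) <= e by [].
  have : 6 * d * V <= e by [].
  move: (d * V) Iy => dV; lra.
exists K, x => l Kl; apply: (le_trans (M1_triangle T0 hE (hs l) (hs K) cx)).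
have : M1 (h l) (h K) <= e by exact: hK.
have -> : eps = 11 * e by rewrite /e; field.
by move: gx; rewrite -/g; lra.
Unshelve. all: by end_near. Qed.

Lemma path_int_M1_const (x : R) w :
  int_oc ((M1_const T x 0)^~ w) 0 T = T * x.
Proof.
have hx : meas_bounded ((M1_const T x 0)^~ w).
  exact/simple_process_meas/simple_process_M1_const.
have hcx := meas_bounded_cst x; have T00 : 0 <= 0 :> R := lexx 0.
rewrite -[T in RHS]subr0 -int_oc_cst ?T00 ?ltW// !int_ocE ?T00 ?ltW//.
by apply: eq_Rintegral => s sT; rewrite /M1_const indicE sT mulr1.
Qed.

(** The expectations E[A_T] of the approximations converge, and their limit
c T is close to x T as soon as h is close to the constant x. *)
Lemma M1G_const : exists c, M1_eq E h (M1_const T c).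
Proof.
have hs k : @simple_process R T (h k) := M1G_simple hh k.
have cs x := simple_process_M1_const x 0 T0.
have ic eta : @simple_process R T eta -> cyl_space T (process_int eta 0 T).
  by move=> heta; apply: (lip_cylT_cyl T0 (lexx T)); exact: process_int_cyl (lexx 0) (ltW T0) heta.
have dist eta eta' : @simple_process R T eta -> @simple_process R T eta' ->
    `|E (process_int eta 0 T) - E (process_int eta' 0 T)| <= M1 eta eta'.
  move=> h1 h2; apply: (expectation_dist_M1 T0 hE h1 h2) => //; try exact: ic.
  by move=> w; apply: process_int_dist => //; exact: ltW.
have Ex x : E (process_int (M1_const T x 0) 0 T) = T * x.
  rewrite (_ : process_int _ 0 T = fun=> T * x) ?(sle_const hE)//.
  by apply/funext => w; rewrite -(path_int_M1_const x w).
pose a k := E (process_int (h k) 0 T).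
have ha k l : `|a k - a l| <= M1 (h k) (h l) by exact: dist.
have ca := M1G_cvg hh ha.
have T00 : 0 <= (0 : R) <= T by rewrite lexx ltW.
exists (limn a / T); rewrite /M1_eq /completion_eq; set c := limn a / T.
have cc x : M1 (M1_const T x 0) (M1_const T c 0) <= `|T * x - limn a|.
  rewrite (_ : T * x - limn a = T * (x - c)); last first.
    by rewrite mulrBr /c mulrCA divff ?mulr1// gt_eqF.
  rewrite -[leRHS](sle_const hE); apply: (sle_mono hE).
  - exact: (path_L1_dist_cyl T0 (cs x) (cs c)).
  - exact: (sle_cst hE).
  move=> w; rewrite -/(path_L1_dist _ _ w) path_L1_distE//.
  rewrite normrM (gtr0_norm T0) -[T in T * _]subr0 -int_oc_cst//.
  apply: int_oc_le => //.
  - exact: (path_L1_dist_meas w (cs x) (cs c)).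
  - exact: meas_bounded_cst.
  - move=> s _; rewrite /M1_const -mulrBl normrM -[leRHS]mulr1 ler_wpM2l//.
    exact: indic_norm_le1.
apply/cvgrPdist_le => e e0.
have [K [x hK]] := M1G_near_const (divr_gt0 e0 (ltr0n R 2)).
have hx : `|T * x - limn a| <= e / 2.
  have hax k : (K <= k)%N -> `|a k - T * x| <= e / 2.
    by move=> Kk; rewrite -Ex (le_trans _ (hK k Kk))// dist.
  rewrite ler_distlC; apply/andP; split.
    apply: limr_ge => //; near=> k; have := hax k; rewrite ler_distl.
    by case/(_ _)/andP => //; near: k; exact: nbhs_infty_ge.
  apply: limr_le => //; near=> k; have := hax k; rewrite ler_distl.
  by case/(_ _)/andP => //; near: k; exact: nbhs_infty_ge.
near=> k; have Kk : (K <= k)%N by near: k; exact: nbhs_infty_ge.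
rewrite sub0r normrN ger0_norm; last exact: le_trans (normr_ge0 _) (dist _ _ (hs k) (cs c)).
apply: (le_trans (M1_triangle T0 hE (hs k) (cs x) (cs c))).
by rewrite (splitr e) lerD// ?hK// (le_trans (cc x)).
Unshelve. all: by end_near. Qed.

End Constant.

Theorem theorem3p2 (R : realType) (T sl sh : R) (hT : 0 < T) (hsl : 0 < sl)
    (hsh : sl < sh) (E : (path_space T -> R) -> R) (hE : G_expectation sl sh E)
    (h : nat -> R -> path_space T -> R) (hh : M1G E h)
    (hstat : stationary_increments E (integral_process h))
    (hindep : independent_increments E (integral_process h)) :
  exists c : R, M1_eq E h (M1_const T c).
Proof. by case: hE => hE0 _; exact: M1G_const hT hE0 hh hstat hindep. Qed.
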